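(* Let $(K,\prec_K)$ be an abstract elementary class with the $\lambda$-amalgamation property and the $\lambda$-joint mapping property, where $\lambda\ge LS(K)$, and let $\kappa$ be a cardinal. Then $\mathfrak{tb}^\kappa_\lambda\ge(\mathfrak{tb}^1_\lambda)^\kappa$. In particular, for every $M\in K_\lambda$, $|gS^\kappa(M)|\ge|gS^1(M)|^\kappa$.
   Context: An abstract elementary class (AEC) is a pair $(K,\prec_K)$ with $K$ a class of structures in a fixed language $L(K)$ and $\prec_K$ a partial order on $K$ such that: $M\prec_K N$ implies $M$ is an $L(K)$-substructure of $N$; $K$ and $\prec_K$ are closed under $L(K)$-isomorphisms; (coherence) if $M_0,M_1\prec_K M_2$ and $M_0\subseteq M_1$ then $M_0\prec_K M_1$; (Tarski–Vaught) the union of a $\prec_K$-increasing continuous chain is in $K$ and $\prec_K$-extends each member, and if each member is $\prec_K N$ then so is the union; and $LS(K)$ is the least infinite cardinal $\ge|L(K)|$ such that for any $M\in K$ and $A\subseteq M$ there is $N\prec_K M$ with $A\subseteq N$ and $\|N\|\le|A|+LS(K)$. $K$ has no models of size $<LS(K)$. $\|M\|$ is the cardinality of $M$, $K_\lambda=\{M\in K:\|M\|=\lambda\}$. A $K$-embedding $f:M\to N$ is an $L(K)$-embedding with $f(M)\prec_K N$. $\lambda$-amalgamation property: whenever $M\prec_K N_0$, $M\prec_K N_1$ with $M,N_0,N_1\in K_\lambda$, there are $N^*\in K$ and $K$-embeddings $f_\ell:N_\ell\to N^*$ ($\ell=0,1$) agreeing on $M$. $\lambda$-joint mapping property: for any $M_0,M_1\in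 K_\lambda$ there are $N\in K$ and $K$-embeddings $f_\ell:M_\ell\to N$. Galois types: for $M\in K$ and an index set $I$, a pretype is a triple $(\langle a_i:i\in I\rangle,M,N)$ with $M\prec_K N$, $\|N\|=\|M\|+|I|$, and each $a_i\in N$. Two pretypes $(\langle a_i\rangle,M,N)$, $(\langle b_i\rangle,M,N')$ over the same $M$ are atomically equivalent if there are $N^*\in K$ and $K$-embeddings $f:N\to N^*$, $g:N'\to N^*$ with $f\upharpoonright M=g\upharpoonright M$ and $f(a_i)=g(b_i)$ for all $i\in I$; $\sim$ is the transitive closure of this relation, $gtp(\langle a_i\rangle/M,N)$ is the $\sim$-class, and $gS^I(M)$ is the set of all such classes; for a cardinal $\kappa$, $gS^\kappa(M)$ uses $I=\kappa$. The type bound is $\mathfrak{tb}^\kappa_\lambda=\sup_{M\in K_\lambda}|gS^\kappa(M)|$.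
   Formalization: Two assumptions are added, without which the claim can fail: κ > 0 or K_λ is nonempty; and if κ ≥ λ, every M in K_λ has a ≺_K-extension of size κ (automatic for κ = λ; otherwise gS^κ(M) is empty). *)

(* Defs.v *)
From HB Require Import structures.
From mathcomp Require Import all_boot all_classical.
From mathcomp Require Import wochoice.
From Stdlib Require Import Relation_Operators.

Set Implicit Arguments.
Unset Strict Implicit.
Unset Printing Implicit Defensive.

Local Open Scope classical_set_scope.
Local Open Scope card_scope.

(** * Cardinals *)

(* A type of the base universe stands for its cardinality: [#<=] and [#=]
   compare cardinals, [A + B] is the cardinal sum and [A -> B] the cardinal
   power |B|^|A|. *)
Definition cardinal := Type.

Lemma card_leTTP (A B : Type) :
  [set: A] #<= [set: B] <-> exists f : A -> B, injective f.
Proof.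
split=> [/card_leP[f]|[f fI]].
  exists (fun a => val (f (exist _ a (mem_set I)))) => a b.
  by move=> /val_inj /(@inj _ _ _ f) - /(_ (mem_set I) (mem_set I)) [].
have fTT : set_fun [set: A] [set: B] f by [].
have fTI : {in [set: A] &, injective f} by move=> a b _ _ /fI.
rewrite -(card_le_eql (inj_card_eq fTI)); exact: card_leT.
Qed.

Lemma card_has_min (J : Type) (j0 : J) (A : J -> Type) :
  exists j, forall k, [set: A j] #<= [set: A k].
Proof.
pose P (X : set (forall j, A j)) :=
  forall j x y, X x -> X y -> x j = y j -> x = y.
have [|X [PX maxX]] := @Zorn_bigcup _ P.
  move=> F FP totF j x y [X FX Xx] [Y FY Yy].
  by have [XY|YX] := totF _ _ FX FY;
    [apply: FP FY _ _ _ (XY _ Xx) Yy|apply: FP FX _ _ _ Xx (YX _ Yy)].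
have [[j jP]|/forallNP noj] := pselect
    (exists j, forall a : A j, exists x, X x /\ x j = a).
  exists j => k; apply/card_leTTP.
  have [f fP] := choice jP.
  exists (fun a => f a k) => a b; have [[Xa fa] [Xb fb]] := (fP a, fP b).
  by move=> /(PX k _ _ Xa Xb) fab; rewrite -fa -fb fab.
have /all_sig[x xP] j : {a : A j | forall x, X x -> x j <> a}.
  by apply: cid; move/existsNP: (noj j) => [a aP]; exists a => x Xx xa;
    apply: aP; exists x.
case: (maxX (X `|` [set x])).
  split=> [y Xy|XxX]; first by left.
  by have /(xP j0) := XxX x (or_intror erefl); exact.
move=> j y z [Xy|->] [Xz|->] //; first exact: PX.
- by move=> /xP-/(_ Xy).
- by move=> /esym/xP-/(_ Xz).
Qed.

Lemma card_sup_exists (J : Type) (F : J -> Type) : exists S : Type,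
  (forall j, [set: F j] #<= [set: S]) /\
  (forall Y : Type, (forall j, [set: F j] #<= [set: Y]) ->
    [set: S] #<= [set: Y]).
Proof.
pose ub (Y : Type) := forall j, [set: F j] #<= [set: Y].
pose ubs (X : set {j & F j}) := ub X.
have ubT : ub [set: {j & F j}].
  move=> j; apply/card_leTTP.
  exists (fun x => exist _ (existT F j x) (mem_set I)) => x y.
  by case=> /(@existT_inj2 (HB.pack J (gen_eqMixin J)) F).
have [[S ubS] minS] := @card_has_min (sig ubs) (exist ubs _ ubT) (fun X => sval X).
exists S; split => // Y ubY.
have [[] le] := @card_has_min bool true (fun b => if b then S : Type else Y).
  exact: (le false).
have /card_leTTP[f fI] := le true.
pose B : set {j & F j} := range (fun y => val (f y)).
have YB : [set: Y] #= B.
  rewrite card_eq_sym; apply: inj_card_eq => y z _ _ /val_inj; exact: fI.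
have TB (T : Type) (C : set T) : [set: C] #= C by exact: card_setT.
have ubB : ub B.
  by move=> j; rewrite (card_le_eqr (TB _ _)) -(card_le_eqr YB).
have := minS (exist ubs B ubB).
by rewrite /= (card_le_eqr (TB _ _)) -(card_le_eqr YB).
Qed.

Definition card_sup (J : Type) (F : J -> Type) : Type :=
  sval (cid (card_sup_exists F)).

Lemma card_supP (J : Type) (F : J -> Type) :
  (forall j, [set: F j] #<= [set: card_sup F]) /\
  (forall Y : Type, (forall j, [set: F j] #<= [set: Y]) ->
    [set: card_sup F] #<= [set: Y]).
Proof. exact: (svalP (cid (card_sup_exists F))). Qed.

(** * Structures *)

Record language := Language {
  fsymbol : cardinal;
  rsymbol : cardinal;
  farity : fsymbol -> nat;
  rarity : rsymbol -> nat }.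

(* The points that the universes of structures are made of. As in set theory,
   universes are small subsets of one fixed large class, so that inclusion of
   structures and unions of chains are literal ones; any small type has a copy
   among the points that avoids a given small set of points. *)
Definition ambient : Type := {T : cardinal & T}.

(* Only the values of [fint] and [rint] on tuples from [univ] are meaningful;
   every notion below depends on these values only. *)
Record structure (L : language) := Structure {
  univ : set ambient;
  fint : forall f : fsymbol L, ('I_(farity f) -> ambient) -> ambient;
  rint : forall r : rsymbol L, ('I_(rarity r) -> ambient) -> Prop;
  univ_small : exists T : cardinal, univ #= [set: T];
  fint_closed : forall f x, (forall i, univ (x i)) -> univ (@fint f x) }.
Arguments fint {L} s f x.
Arguments rint {L} s r x.

Section Structures.
Context {L : language}.
Implicit Types M N : structure L.

Definition substructure M N :=
  [/\ univ M `<=` univ N,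
      forall f x, (forall i, univ M (x i)) -> fint M f x = fint N f x &
      forall r x, (forall i, univ M (x i)) -> (rint M r x <-> rint N r x)].

Definition embedding M N (h : ambient -> ambient) :=
  [/\ set_fun (univ M) (univ N) h,
      {in univ M &, injective h},
      forall f x, (forall i, univ M (x i)) ->
        h (fint M f x) = fint N f (h \o x) &
      forall r x, (forall i, univ M (x i)) ->
        (rint M r x <-> rint N r (h \o x))].

Definition isomorphism M N (h : ambient -> ambient) :=
  embedding M N h /\ h @` univ M = univ N.

Definition is_union (I : Type) (Ms : I -> structure L) (S : set I) M :=
  univ M = \bigcup_(i in S) univ (Ms i) /\
  forall i, S i -> substructure (Ms i) M.

End Structures.

(** * Abstract elementary classes *)

Definition strictly_below (I : Type) (le : rel I) (i : I) : set I :=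
  [set j | le j i /\ j <> i].

Definition limit_index (I : Type) (le : rel I) (i : I) :=
  strictly_below le i !=set0 /\
  forall j, strictly_below le i j ->
    exists2 k, strictly_below le i k & strictly_below le k j.

Section Chains.
Context {L : language}.
Variable prec : structure L -> structure L -> Prop.

(* The index set is an arbitrary nonzero ordinal; a chain of successor length
   has its last member as union. *)
Definition continuous_chain (I : cardinal) (le : rel I)
    (Ms : I -> structure L) :=
  [/\ inhabited I, well_order le,
      forall i j, le i j -> prec (Ms i) (Ms j) &
      forall i, limit_index le i ->
        is_union Ms (strictly_below le i) (Ms i)].

Definition LS_bound (K : set (structure L)) (mu : cardinal) :=
  [/\ infinite_set [set: mu],
      [set: fsymbol L + rsymbol L] #<= [set: mu] &
      forall M, K M -> forall A : set ambient, A `<=` univ M ->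
        exists N, [/\ prec N M, A `<=` univ N &
                      univ N #<= [set: A + mu]]].

End Chains.

(* Antisymmetry of [prec] (equality of universes and of the interpretations on
   them) follows from [prec_sub]. *)
Record AEC := MkAEC {
  lang : language;
  inK : set (structure lang);
  prec : structure lang -> structure lang -> Prop;
  LS : cardinal;
  prec_inK : forall M N, prec M N -> inK M /\ inK N;
  prec_refl : forall M, inK M -> prec M M;
  prec_trans : forall M1 M2 M3, prec M1 M2 -> prec M2 M3 -> prec M1 M3;
  prec_sub : forall M N, prec M N -> substructure M N;
  inK_iso : forall M N h, inK M -> isomorphism M N h -> inK N;
  prec_iso : forall M N M' N' h, prec M N ->
    isomorphism N N' h -> isomorphism M M' h -> prec M' N';
  coherence : forall M0 M1 M2,
    prec M0 M2 -> prec M1 M2 -> substructure M0 M1 -> prec M0 M1;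
  union_inK : forall (I : cardinal) (le : rel I) Ms M,
    continuous_chain prec le Ms -> is_union Ms setT M ->
    inK M /\ forall i, prec (Ms i) M;
  union_prec : forall (I : cardinal) (le : rel I) Ms M N,
    continuous_chain prec le Ms -> is_union Ms setT M ->
    (forall i, prec (Ms i) N) -> prec M N;
  LS_is_bound : LS_bound prec inK LS;
  LS_least : forall mu, LS_bound prec inK mu -> [set: LS] #<= [set: mu];
  LS_le_model : forall M, inK M -> [set: LS] #<= univ M }.
Arguments prec {a}.
Arguments inK : clear implicits.

Section GaloisTypes.
Variable K : AEC.
Local Notation str := (structure (lang K)).
Implicit Types M N : str.

Definition inK_card (lambda : cardinal) : set str :=
  [set M | inK K M /\ univ M #= [set: lambda]].

Definition Kembedding M N (h : ambient -> ambient) :=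
  embedding M N h /\
  exists hM : str, univ hM = h @` univ M /\ prec hM N.

Definition amalgamation (lambda : cardinal) :=
  forall M N0 N1, inK_card lambda M -> inK_card lambda N0 ->
    inK_card lambda N1 -> prec M N0 -> prec M N1 ->
  exists (N : str) (f0 f1 : ambient -> ambient),
    [/\ inK K N, Kembedding N0 N f0, Kembedding N1 N f1 &
        forall x, univ M x -> f0 x = f1 x].

Definition joint_mapping (lambda : cardinal) :=
  forall M0 M1, inK_card lambda M0 -> inK_card lambda M1 ->
  exists (N : str) (f0 f1 : ambient -> ambient),
    [/\ inK K N, Kembedding M0 N f0 & Kembedding M1 N f1].

Record pretype (I : cardinal) M := Pretype {
  elts : I -> ambient;
  model : str;
  prec_model : prec M model;
  card_model : univ model #= [set: univ M + I];
  elts_model : forall i, univ model (elts i) }.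

Definition atomic_equiv (I : cardinal) M (p q : pretype I M) :=
  exists (N : str) (f g : ambient -> ambient),
    [/\ inK K N, Kembedding (model p) N f, Kembedding (model q) N g,
        forall x, univ M x -> f x = g x &
        forall i, f (elts p i) = g (elts q i)].

Definition gtp (I : cardinal) M (p : pretype I M) : set (pretype I M) :=
  [set q | clos_trans _ (@atomic_equiv I M) p q].

Definition gS (I : cardinal) M : set (set (pretype I M)) :=
  range (@gtp I M).
Arguments gS : clear implicits.

Definition tb (kappa lambda : cardinal) : Type :=
  card_sup (fun M : inK_card lambda => gS kappa (val M)).

End GaloisTypes.
Arguments gS : clear implicits.
Arguments inK_card : clear implicits.
Arguments tb : clear implicits.

(* Main.v *)
(* Let M have size lambda. If kappa <= lambda, then any kappa many types over M
   are realized in one extension of M of size lambda, built as the union of a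
   continuous chain along which lambda-amalgamation adds one realization at a
   time; the kappa-type of these realizations determines each of the given
   types, so |gS^kappa(M)| >= |gS^1(M)|^kappa. If kappa >= lambda, then coding
   models on lambda gives |gS^1(M)| <= 2^lambda, whereas the kappa-sequences
   from M alone have at least 2^kappa types.

   Passing to the suprema is immediate when tb^1 is attained, and for
   kappa >= lambda the bound 2^lambda is uniform in M. Otherwise, kappa many
   models have a common extension of size lambda by joint mapping, and the
   number of types grows along extensions, so tb^1 has cofinality above kappa
   and every map from kappa to tb^1 is bounded. Hence
   (tb^1)^kappa <= tb^1 * tb^kappa = tb^kappa. *)

From HB Require Import structures.
Require Import Defs.
From mathcomp Require Import all_boot all_classical wochoice.
From Stdlib Require Import Relation_Operators.

Set Implicit Arguments.
Unset Strict Implicit.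
Unset Printing Implicit Defensive.

Local Open Scope classical_set_scope.
Local Open Scope card_scope.

(** * Infinite cardinals *)

Definition injects (A B : Type) := exists f : A -> B, injective f.

Lemma injects_refl A : injects A A.
Proof. by exists id. Qed.

Lemma injects_trans B A C : injects A B -> injects B C -> injects A C.
Proof. by move=> [f fI] [g gI]; exists (g \o f); exact: inj_comp. Qed.

Lemma injects_total A B : injects A B \/ injects B A.
Proof.
have [[] le] := @card_has_min bool true (fun b => if b then A else B).
  by left; apply/card_leTTP; exact: (le false).
by right; apply/card_leTTP; exact: (le true).
Qed.

Lemma injects_prod A A' B B' :
  injects A A' -> injects B B' -> injects (A * B) (A' * B').
Proof.
move=> [f fI] [g gI]; exists (fun x => (f x.1, g x.2)).
by move=> [a b] [c d] [/fI /= -> /gI /= ->].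
Qed.

Lemma injects_fun I A B : injects A B -> injects (I -> A) (I -> B).
Proof.
move=> [f fI]; exists (fun u => f \o u) => u v /funeqP uv.
by apply/funeqP => i; apply: fI; exact: uv.
Qed.

Lemma injects_Prop A B : injects A B -> injects (A -> Prop) (B -> Prop).
Proof.
move=> [f fI]; exists (fun P => f @` P) => P Q PQ.
suff im R x : (f @` R) (f x) = R x by apply/funext => x; rewrite -im PQ im.
by apply/propext; split=> [[y Ry /fI <-//]|Rx]; exists x.
Qed.

Lemma sval_inj T (P : T -> Prop) : injective (@sval T P).
Proof. by move=> [x Px] [y Py] /= xy; exact: eq_exist. Qed.

(** Hessenberg's theorem by Zorn's lemma. Take a maximal graph [G] of an injection from [A * A] to
    [A] with [A] infinite. If the complement of [A] injects into [A], then so does [X], and the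
    pairing on [A] serves [X]. Otherwise the complement contains a copy of [A], over which [G] could
    be extended. *)
Lemma injects_square X : injects nat X -> injects (X * X) X.
Proof.
case=> e eI.
(* As [P] makes [G] total on the square of its domain, the diagonal is enough to read off the
   domain. *)
pose dom (G : set (X * X * X)) : set X := [set x | exists z, G (x, x, z)].
pose P (G : set (X * X * X)) := [/\ 
  forall x y z z', G (x, y, z) -> G (x, y, z') -> z = z',
  forall x y x' y' z, G (x, y, z) -> G (x', y', z) -> x = x' /\ y = y',
  forall x y z, G (x, y, z) -> [/\ dom G x, dom G y & dom G z] &
  forall x y, dom G x -> dom G y -> exists z, G (x, y, z)].
pose inf (A : set X) := exists2 u : nat -> X, injective u & forall n, A (u n).
pose Q G := G = set0 \/ P G /\ inf (dom G).
have [F FQ Ftot|G [QG Gmax]] := @Zorn_bigcup _ Q.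
  have [[G0 FG0 [t0 G0t]]|F0] := pselect (exists2 G0, F G0 & G0 !=set0); last first.
    by left; apply/seteqP; split=> // t [G FG Gt]; case: F0; exists G => //; exists t.
  have FP G t : F G -> G t -> P G /\ inf (dom G) by move=> /FQ[->|].
  set U := \bigcup_(_ in _) _.
  have sU G : F G -> G `<=` U by move=> FG t Gt; exists G.
  have dU G x : F G -> dom G x -> dom U x.
    by move=> FG [z Gz]; exists z; exact: sU Gz.
  have U2 t t' : U t -> U t' -> exists G, [/\ F G, P G, G t & G t'].
    move=> [G FG Gt] [G' FG' Gt'].
    have [GG|GG] := Ftot _ _ FG FG'.
      by exists G'; split => //; [case: (FP _ _ FG' Gt')|exact: GG].
    by exists G; split => //; [case: (FP _ _ FG Gt)|exact: GG].
  right; split.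
    split.
    - move=> x y z z' Uz Uz'; have [G [FG [+ _ _ _] Gz Gz']] := U2 _ _ Uz Uz'.
      by apply; [exact: Gz|].
    - move=> x y x' y' z Uz Uz'; have [G [FG [_ + _ _] Gz Gz']] := U2 _ _ Uz Uz'.
      by apply; [exact: Gz|].
    - move=> x y z [G FG Gt]; have [[_ _ + _] _] := FP _ _ FG Gt.
      by move=> /(_ _ _ _ Gt)[dx dy dz]; split; exact: (dU _ _ FG).
    - move=> x y [z Uz] [z' Uz'].
      have [G [FG [_ _ _ +] Gz Gz']] := U2 _ _ Uz Uz'.
      move=> /(_ x y)[||t Gt]; [by exists z|by exists z'|].
      by exists t; exact: sU Gt.
  have [_ [u uI ud]] := FP _ _ FG0 G0t.
  by exists u => // n; exact: dU (ud n).
have [PG [u uI ud]] : P G /\ inf (dom G).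
  case: QG => // G0; exfalso.
  (* Were [G] empty, the pairing of [nat] copied along [e] would properly extend it. *)
  pose E : set (X * X * X) :=
    [set t | exists m n, t = (e m, e n, e (pickle (m, n)))].
  have domE x : dom E x <-> exists n, x = e n.
    split=> [[z [m [n [-> _ _]]]]|[n ->]]; first by exists m.
    by exists (e (pickle (n, n))), n, n.
  apply: (Gmax E).
    rewrite G0; split=> // /(_ (e 0, e 0, e (pickle (0, 0)))).
    by apply; exists 0, 0.
  right; split; last by exists e => // n; apply/domE; exists n.
  split.
  - move=> x y z z' [m [n [-> -> ->]]] [m' [n' [/eI <- /eI <- ->]]] //.
  - move=> x y x' y' z [m [n [-> -> ->]]] [m' [n' [-> -> /eI]]].
    by move=> /(pcan_inj pickleK)[-> ->].
  - by move=> x y z [m [n [-> -> ->]]]; split; apply/domE; eexists.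
  - move=> x y /domE[m ->] /domE[n ->].
    by exists (e (pickle (m, n))), m, n.
have {QG} [Gfun Ginj Gdom Gtot] := PG.
pose A := dom G.
have {ud} uA n : A (u n) by exact: ud.
have /choice[f0 f0P] : forall p : X * X, exists z, A p.1 -> A p.2 -> G (p.1, p.2, z).
  move=> [x y]; have [[Ax Ay]|nA] := pselect (A x /\ A y).
    by have [z] := Gtot _ _ Ax Ay; exists z.
  by exists x => Ax Ay; case: nA.
pose f x y := f0 (x, y).
have fG x y : A x -> A y -> G (x, y, f x y) by exact: (f0P (x, y)).
have fA x y : A x -> A y -> A (f x y).
  by move=> Ax Ay; have [] := Gdom _ _ _ (fG x y Ax Ay).
have fI x y x' y' : A x -> A y -> A x' -> A y' -> f x y = f x' y' ->
    x = x' /\ y = y'.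
  move=> Ax Ay Ax' Ay' E; apply: Ginj (fG _ _ Ax Ay) _.
  by rewrite E; exact: fG.
have [[g gI]|[g gI]] := injects_total {x | ~ A x} {x | A x}.
  (* The tags [u 0] and [u 1] keep the images of [A] and of its complement apart. *)
  pose j x := match pselect (A x) with
    | left _ => f (u 0) x | right n => f (u 1) (sval (g (exist _ x n))) end.
  have jA x : A (j x).
    rewrite /j; case: pselect => [Ax|nAx]; apply: fA => //; exact: proj2_sig.
  have jI : injective j.
    move=> x y; rewrite /j.
    case: pselect => [Ax|nAx]; case: pselect => [Ay|nAy] /fI[]//;
      try exact: proj2_sig; try (by move/uI).
    by move=> _ /sval_inj/gI[].
  exists (fun p => f (j p.1) (j p.2)) => -[x y] [x' y'] /=.
  by move=> /fI[]// /jI -> /jI ->.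
pose beta x := match pselect (A x) with
  | left h => sval (g (exist _ x h)) | right _ => x end.
have betaN x : A x -> ~ A (beta x).
  by rewrite /beta => Ax; case: pselect => // h; exact (proj2_sig (g _)).
have betaI x y : A x -> A y -> beta x = beta y -> x = y.
  rewrite /beta => Ax Ay; case: pselect => // hx; case: pselect => // hy.
  by move=> /sval_inj/gI[].
pose C x := A x \/ exists2 y, A y & x = beta y.
(* [bar] fixes the points of [A] and undoes [beta] on their copies. *)
have /choice[bar barP] : forall x, exists y, C x ->
    A y /\ (if pselect (A x) then x = y else x = beta y).
  move=> x; have [Cx|nC] := pselect (C x); last by exists x.
  case: pselect => Ax /=; first by exists x.
  by case: Cx => // -[y Ay ->]; exists y.
have barA x : C x -> A (bar x) by move=> /barP[].
have barAE x : A x -> bar x = x.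
  move=> Ax; have Cx : C x by left.
  by have [_] := barP _ Cx; case: pselect.
have barBE x : C x -> ~ A x -> x = beta (bar x).
  by move=> Cx nAx; have [_] := barP _ Cx; case: pselect.
(* For pairs not inside [A], three tags record which coordinates lie in [A]: only the first, only
   the second, or neither. *)
pose k x y := if pselect (A x) then u 0 else if pselect (A y) then u 1 else u 2.
have kA x y : A (k x y) by rewrite /k; do 2![case: pselect => * //=].
pose w x y := f (k x y) (f (bar x) (bar y)).
have wA x y : C x -> C y -> A (w x y).
  by move=> Cx Cy; apply: (fA) => //; apply: (fA); exact: (barA).
have wI x y x' y' : C x -> C y -> C x' -> C y' -> ~ (A x /\ A y) ->
    ~ (A x' /\ A y') -> w x y = w x' y' -> x = x' /\ y = y'.
  move=> Cx Cy Cx' Cy' nA nA'.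
  move=> /fI[]//; try by [apply: fA; exact: barA|].
  move=> kk /fI[]; try exact: barA.
  have kAx : A x <-> A x'.
    move: kk; rewrite /k; case: pselect => Ax /=; case: pselect => Ax' //=;
      case: pselect => Ay //=; try case: pselect => Ay' //=; try move=> /uI //;
      by case: nA.
  have kAy : A y <-> A y'.
    move: kk; rewrite /k; case: pselect => Ax /=; case: pselect => Ax' //=;
      do ?[case: pselect => ? //=]; try move=> /uI //; try tauto.
  move=> bx by_; split.
    have [Ax|nAx] := pselect (A x).
      by rewrite -(barAE x)// -(barAE x')//; exact/kAx.
    rewrite (barBE x)// (barBE x')// ?bx // => /kAx//.
  have [Ay|nAy] := pselect (A y).
    by rewrite -(barAE y)// -(barAE y')//; exact/kAy.
  by rewrite (barBE y)// (barBE y')// ?by_ // => /kAy.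
(* New pairs take values in the copy of [A], so they cannot clash with the old values, which lie in
   [A]. *)
pose G' : set (X * X * X) := G `|` [set t | exists x y,
   [/\ C x, C y, ~ (A x /\ A y) & t = (x, y, beta (w x y))]].
have domG' x : dom G' x <-> C x.
  split=> [[z [Gz|[x' [y' [Cx _ _ [-> _ _]]]]]]|Cx] //.
    by left; exists z.
  have [[z Gz]|nAx] := pselect (A x); first by exists z; left.
  by exists (beta (w x x)); right; exists x, x; split => // -[].
exfalso; apply: (Gmax G').
  split=> [t Gt|G'G]; first by left.
  have nA : ~ A (beta (u 0)) by exact: betaN.
  have Cb : C (beta (u 0)) by right; exists (u 0).
  have /G'G : G' (beta (u 0), beta (u 0), beta (w (beta (u 0)) (beta (u 0)))).
    by right; exists (beta (u 0)), (beta (u 0)); split => // -[].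
  by move/Gdom => [].
right; split; last by exists u => // n; apply/domG'; left.
split.
- move=> x y z z' [Gz|[a [b [Ca Cb nab [-> -> ->]]]]]
    [Gz'|[a' [b' [Ca' Cb' nab' E]]]].
  + exact: Gfun Gz Gz'.
  + by move: E nab' => [<- <- _]; case; have [] := Gdom _ _ _ Gz.
  + by case: nab; have [] := Gdom _ _ _ Gz'.
  + by case: E => -> -> ->.
- move=> x y x' y' z [Gz|[a [b [Ca Cb nab [-> -> ->]]]]]
    [Gz'|[a' [b' [Ca' Cb' nab' [-> -> E]]]]].
  + exact: Ginj Gz Gz'.
  + by have [_ _] := Gdom _ _ _ Gz; rewrite E => /(betaN _ (wA _ _ Ca' Cb')).
  + by have [_ _ /(betaN _ (wA _ _ Ca Cb))] := Gdom _ _ _ Gz'.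
  + by move/betaI: E => /(_ (wA _ _ Ca Cb) (wA _ _ Ca' Cb')) /wI; apply.
- move=> x y z [Gz|[a [b [Ca Cb nab [-> -> ->]]]]].
    by have [? ? ?] := Gdom _ _ _ Gz; split; apply/domG'; left.
  by split; apply/domG' => //; right; exists (w a b) => //; exact: wA.
- move=> x y /domG' Cx /domG' Cy.
  have [[Ax Ay]|nA] := pselect (A x /\ A y).
    by exists (f x y); left; exact: fG.
  by exists (beta (w x y)); right; exists x, y.
Qed.

Lemma injects_prod_infinite X A B : injects nat X ->
  injects A X -> injects B X -> injects (A * B) X.
Proof.
by move=> nX AX BX; apply: injects_trans (injects_square nX); exact: injects_prod.
Qed.

Lemma injects_sum_infinite X A B : injects nat X ->
  injects A X -> injects B X -> injects (A + B) X.
Proof.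
move=> nX [f fI] [g gI]; have [e eI] := nX.
apply: injects_trans (injects_square nX).
exists (fun x => match x with inl a => (e 0, f a) | inr b => (e 1, g b) end).
by move=> [a|b] [c|d] [] => [/fI->|/eI|/eI|/gI->].
Qed.

Lemma injects_unit_infinite X : injects nat X -> injects unit X.
Proof. by move=> [e eI]; exists (fun=> e 0) => -[] []. Qed.

(** The length is stored next to the nested pairing, since the final value [e 0] need not be
    recognizable as the end of the code. *)
Lemma injects_seq_infinite X A : injects nat X -> injects A X ->
  injects (seq A) X.
Proof.
move=> nX AX; have [j jI] := injects_prod_infinite nX AX (injects_refl X).
have [e _] := nX; apply: injects_trans (injects_prod_infinite nX nX (injects_refl X)).
exists (fun s => (size s, foldr (fun a x => j (a, x)) (e 0) s)).
by elim=> [|a s IH] [|b t] //= [st /jI[-> E]]; congr cons; apply: IH; rewrite st E.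
Qed.

Lemma card_le_injectsP T (A : set T) B : A #<= [set: B] <-> injects A B.
Proof. by rewrite -(card_le_eql (card_setT A)); exact: card_leTTP. Qed.

Lemma card_ge_injectsP T (A : set T) B : [set: B] #<= A <-> injects B A.
Proof. by rewrite -(card_le_eqr (card_setT A)); exact: card_leTTP. Qed.

Lemma card_eq_injectsP T (A : set T) B :
  A #= [set: B] <-> injects A B /\ injects B A.
Proof.
split=> [/card_eqPle[AB BA]|[/card_le_injectsP AB /card_ge_injectsP BA]].
  by split; [apply/card_le_injectsP|apply/card_ge_injectsP].
by apply/card_eqPle; split.
Qed.

Lemma infinite_injectsP X : infinite_set [set: X] <-> injects nat X.
Proof. by rewrite infiniteP; exact: card_leTTP. Qed.

Lemma injects_subset T (A B : set T) : A `<=` B -> injects A B.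
Proof.
move=> AB; apply/card_le_injectsP; rewrite (card_le_eqr (card_setT B)).
exact: subset_card_le.
Qed.

Lemma injects_image T U (f : T -> U) (A : set T) : injects (f @` A) A.
Proof.
apply/card_le_injectsP; rewrite (card_le_eqr (card_setT A)).
exact: card_image_le.
Qed.

Lemma injects_inj_image T U (f : T -> U) (A : set T) :
  {in A &, injective f} -> injects A (f @` A).
Proof.
move=> fI; apply/card_le_injectsP; rewrite (card_le_eqr (card_setT _)).
by have := inj_card_eq fI; rewrite card_eq_sym => /card_eqPle[].
Qed.

Lemma injects_setU T (A B : set T) X : injects nat X ->
  injects A X -> injects B X -> injects (A `|` B) X.
Proof.
move=> nX AX BX; apply: injects_trans (injects_sum_infinite nX AX BX).
pose s (x : A `|` B) : (A + B)%type := match pselect (A (val x)) with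
  | left h => inl (SigSub (mem_set h))
  | right h => inr (SigSub (mem_set
      (match set_mem (valP x) with or_introl a => match h a with end
                                 | or_intror b => b end))) end.
exists s => x y; rewrite /s.
by do 2!case: pselect => // ?; move=> -[] xy; exact: val_inj.
Qed.

Lemma injects_bigcup I T (F : I -> set T) X : injects nat X ->
  injects I X -> (forall i, injects (F i) X) -> injects (\bigcup_i F i) X.
Proof.
move=> nX IX FX; apply: injects_trans (injects_prod_infinite nX IX (injects_refl X)).
have /all_sig[g gI] i : {g : F i -> X | injective g} by apply: cid; exact: FX.
have /choice[c cF] : forall x : \bigcup_i F i, exists i, F i (val x).
  by move=> x; have [i _ Fi] := set_mem (valP x); exists i.
exists (fun x => (c x, g (c x) (SigSub (mem_set (cF x))))) => x y [].
move: (cF x) (cF y) => + + cxy; rewrite cxy => cx cy /gI[].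
exact: val_inj.
Qed.

(** * Well orders, transfinite recursion and initial ordinals *)

Section WellOrder.
Variables (I : Type) (le : rel I).
Hypothesis wo : well_order le.

Lemma wo_min (A : set I) : A !=set0 ->
  exists2 z, A z & forall x, A x -> le z x.
Proof.
move=> [x Ax]; have [|z [[zA zmin] _]] := wo (A := [pred x | `[< A x >]]).
  by exists x; exact/asboolP.
by exists z => [|y Ay]; [exact/asboolP|apply: zmin; exact/asboolP].
Qed.

Lemma wo_total x y : le x y \/ le y x.
Proof.
have [|z [->|->] zmin] := @wo_min [set x; y]; first by exists x; left.
  by left; apply: zmin; right.
by right; apply: zmin; left.
Qed.

Lemma wo_refl x : le x x.
Proof. by case: (wo_total x x). Qed.

Lemma wo_antisym x y : le x y -> le y x -> x = y.
Proof.
move=> xy yx.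
have [|z [_ zU]] := wo (A := [pred t | `[< t = x \/ t = y >]]).
  by exists x; apply/asboolP; left.
have zx : z = x.
  apply: zU; split; first by apply/asboolP; left.
  by move=> t /asboolP[]->; rewrite ?wo_refl.
rewrite -zx; apply: zU; split; first by apply/asboolP; right.
by move=> t /asboolP[]->; rewrite ?wo_refl.
Qed.

Lemma wo_trans x y z : le x y -> le y z -> le x z.
Proof.
move=> xy yz.
have [|t txyz tmin] := @wo_min [set t | t = x \/ t = y \/ t = z].
  by exists x; left.
have [tx ty tz] : [/\ le t x, le t y & le t z] by split; apply: tmin => /=; tauto.
case: txyz => [<-//|[ty'|tz']].
  by rewrite ty' in tx; rewrite (wo_antisym xy tx).
by rewrite tz' in ty; rewrite -(wo_antisym yz ty).
Qed.

Lemma wo_lt_wf : well_founded (fun j i => strictly_below le i j).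
Proof.
move=> i; apply: contrapT => nAi.
have [|z nz zmin] := @wo_min [set i | ~ Acc (fun j i => strictly_below le i j) i].
  by exists i.
apply: nz; split=> j [ji jNi]; apply: contrapT => /zmin ij.
by apply: jNi; exact: wo_antisym.
Qed.

Lemma wo_not_below i j : ~ strictly_below le i j -> le i j.
Proof.
move=> nji; have [ji|//] := wo_total j i.
by have [->|ne] := pselect (j = i); [exact: wo_refl|case: nji].
Qed.

Lemma wo_below_le i j k :
  strictly_below le i j -> le k j -> strictly_below le i k.
Proof.
move=> [ji ne] kj; split; first exact: wo_trans ji.
by move=> ki; apply: ne; apply: wo_antisym; rewrite // -ki.
Qed.

Lemma wo_sub (S : set I) :
  well_order (fun x y : {i | S i} => le (sval x) (sval y)).
Proof.
apply: antisymmetric_well_order.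
  by move=> x y /andP[xy yx]; apply: sval_inj; exact: wo_antisym.
move=> A [x xA].
have [|_ [a [<- aA]] zmin] := @wo_min [set i | exists a : {i | S i}, sval a = i /\ a \in A].
  by exists (sval x), x.
by exists a; split=> // b bA; apply: zmin; exists b.
Qed.

(** [R i B U] says that [U] is admissible at [i] after the earlier values [B]. Existence is assumed
    only after admissible earlier values, so the recursion chooses a value whenever there is one,
    and induction shows afterwards that there always was. *)
Lemma wo_recursion T (R : I -> (I -> T) -> T -> Prop) : inhabited T ->
  (forall i B B' U, (forall j, strictly_below le i j -> B j = B' j) ->
    R i B U -> R i B' U) ->
  (forall i B, (forall j, strictly_below le i j -> R j B (B j)) ->
    exists U, R i B U) ->
  exists B, forall i, R i B (B i).
Proof.
move=> [t0] Rext Rex.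
(* Off the predecessors of [i] the value is the default [t0], which [Rext] makes harmless. *)
pose glue i (rec : forall j, strictly_below le i j -> T) j :=
  if pselect (strictly_below le i j) is left h then rec j h else t0.
pose F i (rec : forall j, strictly_below le i j -> T) :=
  if pselect (exists U, R i (glue i rec) U) is left h then sval (cid h) else t0.
pose B := Fix wo_lt_wf (fun=> T) F.
have BE i : B i = F i (fun j _ => B j).
  apply: (Fix_eq wo_lt_wf (fun=> T) F) => {}i f g fg.
  by congr F; do 2!apply: functional_extensionality_dep => ?; exact: fg.
exists B => i; elim: (wo_lt_wf i) => {}i _ IH.
have glueE j : strictly_below le i j -> glue i (fun j _ => B j) j = B j.
  by rewrite /glue; case: pselect.
have [U RU] := Rex i B IH.
rewrite BE /F; case: pselect => [h|[]].
  by apply: Rext (svalP (cid h)) => j /glueE.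
by exists U; apply: Rext RU => j /glueE.
Qed.

End WellOrder.

Lemma exists_well_order I : exists le : rel I, well_order le.
Proof.
by have [le] := @well_ordering_principle (HB.pack I (gen_eqMixin I)); exists le.
Qed.

(** Orders [T] as an initial ordinal. If [T] injects into some proper segment of a well order, the
    order of the shortest such segment is pulled back to [T]. *)
Lemma initial_order T : exists lt : T -> T -> Prop,
  (forall s t, [\/ lt s t, s = t | lt t s]) /\
  forall t, ~ injects T {s | lt s t}.
Proof.
have [le wo] := exists_well_order T.
have below_total s t : [\/ strictly_below le t s, s = t | strictly_below le s t].
  have [->|ne] := pselect (s = t); first by constructor 2.
  by have [st|ts] := wo_total wo s t; [constructor 1|constructor 3];
    split => // /esym.
have [[t0 t0P]|/forallNP small] :=
  pselect (exists t, injects T {s | strictly_below le t s}); last first.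
  by exists (fun s t => strictly_below le t s).
have [|t [f fI] tmin] := @wo_min _ _ wo [set t | injects T {s | strictly_below le t s}].
  by exists t0.
exists (fun s t => strictly_below le (sval (f t)) (sval (f s))); split=> [r s|s [g gI]].
  have [?|/sval_inj/fI ?|?] := below_total (sval (f r)) (sval (f s));
    by [constructor 1|constructor 2|constructor 3].
have [fst ne] := proj2_sig (f s).
(* Through [g], already the segment below [f s] receives [T]; minimality of [t] then contradicts
   that [f s] lies strictly below [t]. *)
case: (ne); apply: (wo_antisym wo) => //; apply: tmin.
exists (fun x => exist _ (sval (f (sval (g x)))) (proj2_sig (g x))).
by move=> x y [/sval_inj/fI/sval_inj/gI].
Qed.

(** * Renaming of structures *)

Definition small (A : set ambient) := exists T : cardinal, A #= [set: T].

Lemma Cantor_injects X : ~ injects (X -> Prop) X.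
Proof.
move=> [g gI]; pose D x := exists2 P, g P = x & ~ P x.
have nD : ~ D (g D) by move=> DgD; case: (DgD) => P /gI ->.
by apply: (nD); exists D.
Qed.

Lemma existT_ambient_inj (T : cardinal) (x y : T) :
  existT id T x = existT id T y -> x = y.
Proof. exact: (@existT_inj2 (HB.pack cardinal (gen_eqMixin cardinal)) id). Qed.

(* The copy of [B] lives in a power set, which by Cantor's theorem is too large
   to be the type of a point of [A]. *)
Lemma fresh_copy (A B : set ambient) : small A -> small B ->
  exists c : ambient -> ambient,
    {in B &, injective c} /\ forall y, B y -> ~ A (c y).
Proof.
move=> [T0 /card_eq_injectsP[[i iI] _]] [T1 /card_eq_injectsP[[j jI] _]].
(* [F t] is the type of the point of [A] coded by [t], with [unit] as default. *)
pose F (t : T0) : cardinal := if pselect (exists a, i a = t) is left h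
  then projT1 (val (sval (cid h))) else unit.
have Fi a : F (i a) = projT1 (val a).
  rewrite /F; case: pselect => [h|[]]; last by exists a.
  by case: (cid h) => b /= /iI ->.
(* The summand [T1] holds the codes of the points of [B], which are copied to singletons; the other
   summand contains every [F t], so no [F t] equals the power set [Y]. *)
pose X : cardinal := (T1 + {t & F t})%type.
pose Y : cardinal := X -> Prop.
have FY t : F t <> Y.
  move=> FtY; apply: (@Cantor_injects X).
  suff inj (Z : cardinal) : F t = Z -> injects Z X by exact: inj.
  move=> <-; exists (fun x => inr (existT F t x)) => x y [].
  exact: (@existT_inj2 (HB.pack T0 (gen_eqMixin T0)) F).
exists (fun y => if pselect (B y) is left h
  then existT id Y (fun s => s = inl (j (SigSub (mem_set h)))) else y).
split=> [y z /set_mem By /set_mem Bz|y By].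
  case: pselect => // hy; case: pselect => // hz E0; have E := existT_ambient_inj E0.
  have /= := congr1 (fun P : Y => P (inl (j (SigSub (mem_set hy))))) E.
  by move/esym; rewrite propeqE => -[_ /(_ erefl)[/jI[]]].
case: pselect => // h Ac; apply: (FY (i (SigSub (mem_set Ac)))).
by rewrite Fi.
Qed.

Lemma inverse_on (A : set ambient) (e : ambient -> ambient) :
  {in A &, injective e} -> exists e', forall y, A y -> e' (e y) = y.
Proof.
move=> eI; have /choice[e' e'P] : forall x, exists y,
    (exists2 z, A z & e z = x) -> A y /\ e y = x.
  move=> x; have [[z Az zx]|n] := pselect (exists2 z, A z & e z = x).
    by exists z.
  by exists x => /n.
exists e' => y Ay; have [|Ae' ee'] := e'P (e y); first by exists y.
by apply: eI; rewrite ?inE.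
Qed.

Section Structures.
Context {L : language}.
Implicit Types M N P U : structure L.

Lemma substructure_refl M : substructure M M.
Proof. by split. Qed.

Lemma substructure_sub M N P : substructure M P -> substructure N P ->
  univ M `<=` univ N -> substructure M N.
Proof.
move=> [MP Mf Mr] [NP Nf Nr] MN; split=> // [f x Mx|r x Mx].
  by rewrite Mf// Nf// => i; exact: MN.
by rewrite Mr// Nr// => i; exact: MN.
Qed.

Lemma embedding_comp M N P f g :
  embedding M N f -> embedding N P g -> embedding M P (g \o f).
Proof.
move=> [fMN fI ff fr] [gNP gI gf gr].
have fN n (x : 'I_n -> ambient) : (forall i, univ M (x i)) -> forall i, univ N ((f \o x) i).
  by move=> Mx i; exact: fMN.
split=> [x Mx|x y Mx My gfxy|s x Mx|r x Mx].
- exact/gNP/fMN.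
- by apply: fI => //; apply: gI => //; rewrite inE; apply: fMN; exact: set_mem.
- by rewrite /= ff// gf//; exact: fN.
- by rewrite fr// gr//; exact: fN.
Qed.

Lemma substructure_embedding M N : substructure M N -> embedding M N id.
Proof. by move=> [MN Mf Mr]; split. Qed.

Lemma embedding_substructure M N P f :
  embedding M P f -> substructure N P -> f @` univ M `<=` univ N ->
  embedding M N f.
Proof.
move=> [fMP fI ff fr] [NP Nf Nr] fMN.
have fN n (x : 'I_n -> ambient) : (forall i, univ M (x i)) -> forall i, univ N ((f \o x) i).
  by move=> Mx i; apply: fMN; exists (x i).
split=> // [x Mx|s x Mx|r x Mx]; first by apply: fMN; exists x.
  by rewrite Nf ?ff//; exact: fN.
by rewrite Nr ?fr//; exact: fN.
Qed.

Lemma image_isomorphism M N P f : embedding M P f -> substructure N P ->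
  univ N = f @` univ M -> isomorphism M N f.
Proof.
by move=> Mf NP NE; split=> //; apply: embedding_substructure NP _; rewrite ?NE.
Qed.

Lemma isomorphism_inverse M N h : isomorphism M N h ->
  exists h', [/\ isomorphism N M h', forall x, univ M x -> h' (h x) = x &
                 forall y, univ N y -> h (h' y) = y].
Proof.
move=> [[hMN hI hf hr] hN]; have [h' h'K] := inverse_on hI.
have hK y : univ N y -> univ M (h' y) /\ h (h' y) = y.
  by rewrite -hN => -[x Mx <-]; rewrite h'K.
have hKx n (x : 'I_n -> ambient) : (forall i, univ N (x i)) -> h \o (h' \o x) = x.
  by move=> Nx; apply/funext => i /=; have [] := hK _ (Nx i).
have h'M n (x : 'I_n -> ambient) : (forall i, univ N (x i)) ->
  forall i, univ M ((h' \o x) i) by move=> Nx i /=; have [] := hK _ (Nx i).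
exists h'; split=> // [|y /hK[]//]; split; last first.
  apply/seteqP; split=> [_ [y /hK[My _] <-//]|x Mx].
  by exists (h x); [exact: hMN|exact: h'K].
split=> [y /hK[]//|y z /set_mem Ny /set_mem Nz yz|f x Nx|r x Nx].
- by have [_ <-] := hK _ Ny; have [_ <-] := hK _ Nz; rewrite yz.
- rewrite -{1}[x]hKx// -hf; last exact: h'M.
  by rewrite h'K//; apply: fint_closed; exact: h'M.
- by rewrite hr ?hKx//; exact: h'M.
Qed.

Lemma isomorphism_card M N h : isomorphism M N h -> univ M #= univ N.
Proof. by move=> [[_ hI _ _] <-]; rewrite card_eq_sym; exact: inj_card_eq. Qed.

Lemma transport_structure N (e : ambient -> ambient) :
  {in univ N &, injective e} -> exists U, isomorphism N U e.
Proof.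
move=> eI; have [e' e'K] := inverse_on eI.
have e'N n (x : 'I_n -> ambient) : (forall i, (e @` univ N) (x i)) ->
    forall i, univ N ((e' \o x) i).
  by move=> Nx i /=; have [y Ny <-] := Nx i; rewrite e'K.
have sm : small (e @` univ N).
  by have [T NT] := univ_small N; exists T; apply: card_eq_trans NT; exact: inj_card_eq.
exists (@Structure L (e @` univ N) (fun f x => e (fint N f (e' \o x)))
   (fun r x => rint N r (e' \o x)) sm
   (fun f x Nx => imageP e (fint_closed (e'N _ _ Nx)))).
have e'Kx n (x : 'I_n -> ambient) : (forall i, univ N (x i)) -> e' \o (e \o x) = x.
  by move=> Nx; apply/funext => i /=; rewrite e'K.
split=> //; split=> //= [f x Nx|r x Nx].
  by rewrite e'Kx.
by rewrite e'Kx.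
Qed.

(** Turns an embedding into a literal extension: the points [f x] are renamed back to [x], and the
    other points of [N] get fresh names outside [M]. *)
Lemma rename_extension M N f : embedding M N f ->
  exists U h, [/\ substructure M U, isomorphism U N h &
                  forall x, univ M x -> h x = f x].
Proof.
move=> [fMN fI ff fr]; have [c [cI cM]] := fresh_copy (univ_small M) (univ_small N).
have [f' f'K] := inverse_on fI.
pose e y := if pselect ((f @` univ M) y) is left _ then f' y else c y.
have ef x : univ M x -> e (f x) = x.
  by move=> Mx; rewrite /e; case: pselect => [_|[]]; [rewrite f'K|exists x].
have eI : {in univ N &, injective e}.
  move=> y z Ny Nz; rewrite /e; case: pselect => [[x Mx <-]|ny];
    case: pselect => [[x' Mx' <-]|nz]; rewrite ?f'K//.
  - by move=> ->.
  - by move=> xc; case: (cM z); [exact: set_mem|rewrite -xc].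
  - by move=> xc; case: (cM y); [exact: set_mem|rewrite xc].
  - exact: cI.
have [U isoU] := transport_structure eI.
have [h [isoh hK Kh]] := isomorphism_inverse isoU.
exists U, h; split=> // [|x Mx]; last by rewrite -{1}(ef x Mx) hK//; exact: fMN.
case: isoU => -[eNU _ ef' er'] _.
have eUx n (x : 'I_n -> ambient) : (forall i, univ M (x i)) -> e \o (f \o x) = x.
  by move=> Mx; apply/funext => i /=; rewrite ef.
have fNx n (x : 'I_n -> ambient) : (forall i, univ M (x i)) ->
  forall i, univ N ((f \o x) i) by move=> Mx i; exact: fMN.
split=> [x Mx|s x Mx|r x Mx].
- by rewrite -(ef x Mx); apply: eNU; exact: fMN.
- rewrite -{2}[x]eUx// -ef'; last exact: fNx.
  by rewrite -ff// ef//; exact: fint_closed.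
- rewrite -{2}[x]eUx// -er'; last exact: fNx.
  exact: fr.
Qed.

End Structures.

(** * Amalgamation inside [K_lambda] *)

Section Kembeddings.
Variable K : AEC.
Implicit Types M N P U : structure (lang K).

Lemma isomorphism_Kembedding M N h :
  inK K N -> isomorphism M N h -> Kembedding M N h.
Proof. by move=> KN [hMN hE]; split=> //; exists N; split=> //; exact: prec_refl. Qed.

Lemma prec_Kembedding M N : prec M N -> Kembedding M N id.
Proof.
move=> MN; split; first exact/substructure_embedding/prec_sub.
by exists M; rewrite image_id.
Qed.

Lemma Kembedding_inK M N h : Kembedding M N h -> inK K N.
Proof. by move=> [_ [hM [_ /prec_inK[]]]]. Qed.

(** The image of [M] in [N] is transported along [g] into the image of [N] in [P]; [prec_iso] and
    transitivity then apply. *)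
Lemma Kembedding_comp M N P f g :
  Kembedding M N f -> Kembedding N P g -> Kembedding M P (g \o f).
Proof.
move=> [Mf [fM [fME fMN]]] [Ng [gN [gNE gNP]]].
split; first exact: embedding_comp Mf Ng.
have isog := image_isomorphism Ng (prec_sub gNP) gNE.
have [X isoX] : exists X, isomorphism fM X g.
  apply: transport_structure; case: isog => -[_ gI _ _] _ x y fx fy.
  have [fMsub _ _] := prec_sub fMN.
  by apply: gI; rewrite inE; apply: fMsub; exact: set_mem.
exists X; split; last exact: prec_trans (prec_iso fMN isog isoX) gNP.
by case: isoX => _ <-; rewrite fME image_comp.
Qed.

Lemma Kembedding_precr M N P f :
  Kembedding M N f -> prec N P -> Kembedding M P f.
Proof. by move=> Mf /prec_Kembedding/(Kembedding_comp Mf). Qed.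

Lemma Kembedding_coherence M N P f :
  Kembedding M P f -> prec N P -> f @` univ M `<=` univ N -> Kembedding M N f.
Proof.
move=> [Mf [fM [fME fMP]]] NP fMN; split.
  exact: embedding_substructure Mf (prec_sub NP) fMN.
exists fM; split=> //; apply: (coherence fMP NP).
by apply: (substructure_sub (prec_sub fMP) (prec_sub NP)); rewrite fME.
Qed.

Lemma Kembedding_rename M N f : Kembedding M N f ->
  exists U h, [/\ prec M U, isomorphism U N h & forall x, univ M x -> h x = f x].
Proof.
move=> [Mf [fM [fME fMN]]]; have [U [h [MU isoh hf]]] := rename_extension Mf.
exists U, h; split=> //; have [h' [isoh' h'K hK]] := isomorphism_inverse isoh.
apply: (prec_iso fMN isoh').
apply: (@image_isomorphism _ _ _ U) => //.
  apply: (embedding_comp (substructure_embedding (prec_sub fMN))).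
  by case: isoh'.
have [MUu _ _] := MU.
rewrite fME image_comp; apply/seteqP; split=> [x Mx|_ [x Mx <-]] /=.
  by exists x => //=; rewrite -hf// h'K//; exact: MUu.
by rewrite -hf// h'K//; exact: MUu.
Qed.

Variable lambda : cardinal.
Hypothesis lambda_ge_LS : [set: LS K] #<= [set: lambda].

Lemma lambda_infinite : injects nat lambda.
Proof.
have [/infinite_injectsP nLS _ _] := LS_is_bound K.
by apply: injects_trans nLS _; exact/card_leTTP.
Qed.

Lemma inK_cardP M :
  inK_card K lambda M <->
  [/\ inK K M, injects (univ M) lambda & injects lambda (univ M)].
Proof.
rewrite /inK_card /=; split=> [[KM /card_eq_injectsP[]]|[KM Ml lM]] //.
by split=> //; apply/card_eq_injectsP.
Qed.

Lemma inK_card_iso M N h :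
  inK_card K lambda M -> isomorphism M N h -> inK_card K lambda N.
Proof.
move=> [KM Ml] iso; split; first exact: inK_iso iso.
by have := isomorphism_card iso; rewrite card_eq_sym => /card_eq_trans; apply.
Qed.

Lemma Lowenheim_Skolem P (A : set ambient) : inK K P -> A `<=` univ P ->
  injects A lambda -> injects lambda A ->
  exists N, [/\ prec N P, A `<=` univ N & inK_card K lambda N].
Proof.
move=> KP AP Al lA; have [_ _ /(_ P KP A AP)[N [NP AN Ncard]]] := LS_is_bound K.
exists N; split=> //; apply/inK_cardP; split; first by have [] := prec_inK NP.
  apply: (injects_trans (B := (A + LS K)%type)); first exact/card_le_injectsP.
  by apply: injects_sum_infinite lambda_infinite _ _ => //; exact/card_leTTP.
by apply: injects_trans lA _; exact: injects_subset.
Qed.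

(** A submodel of size [lambda] around the union of the two images is a target as well, by
    coherence; [P] itself may be of any size. *)
Lemma cut_to_lambda P N0 N1 f0 f1 :
  inK_card K lambda N0 -> inK_card K lambda N1 ->
  Kembedding N0 P f0 -> Kembedding N1 P f1 ->
  exists N, [/\ inK_card K lambda N, Kembedding N0 N f0 & Kembedding N1 N f1].
Proof.
move=> /inK_cardP[KN0 N0l lN0] /inK_cardP[KN1 N1l lN1] e0 e1.
have [||||N [NP AN Nl]] := @Lowenheim_Skolem P (f0 @` univ N0 `|` f1 @` univ N1).
- exact: Kembedding_inK e0.
- by case: e0 e1 => -[+ _ _ _] _ [[+ _ _ _] _] => m0 m1 _ [] [x Nx <-];
    [exact: m0|exact: m1].
- by apply: injects_setU lambda_infinite _ _; exact: injects_trans (injects_image _ _) _.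
- apply: injects_trans lN0 _; apply: injects_trans; last first.
    by apply: injects_subset => x; left; eassumption.
  by apply: injects_inj_image; case: e0 => -[].
exists N; split=> //.
  by apply: (Kembedding_coherence e0 NP) => x f0x; apply: AN; left.
by apply: (Kembedding_coherence e1 NP) => x f1x; apply: AN; right.
Qed.

(** Renaming [P] along [F0] makes [N0] a literal submodel, as chains are built from [prec] and not
    from embeddings. *)
Lemma absorb_target N0 N1 P F0 F1 : inK_card K lambda P ->
  Kembedding N0 P F0 -> Kembedding N1 P F1 ->
  exists U g, [/\ inK_card K lambda U, prec N0 U, Kembedding N1 U g &
    forall x y, univ N0 x -> univ N1 y -> F0 x = F1 y -> g y = x].
Proof.
move=> Pl e0 e1; have [U [e [N0U isoe eF0]]] := Kembedding_rename e0.
have [e' [isoe' e'K eK]] := isomorphism_inverse isoe.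
have Ul := inK_card_iso Pl isoe'.
exists U, (e' \o F1); split=> //.
  apply: Kembedding_comp e1 _; apply: isomorphism_Kembedding isoe'.
  by case: Ul.
move=> x y N0x N1y E /=; rewrite -E -eF0// e'K//.
by have [+ _ _] := prec_sub N0U; apply.
Qed.

(** [amalgamation] speaks of literal extensions of [M], so both targets are first renamed over [M];
    the amalgam is then cut to size [lambda] and made to extend [N0]. *)
Lemma amalgamation_extension M N0 N1 h0 h1 : amalgamation K lambda ->
  inK_card K lambda M -> inK_card K lambda N0 -> inK_card K lambda N1 ->
  Kembedding M N0 h0 -> Kembedding M N1 h1 ->
  exists U g, [/\ inK_card K lambda U, prec N0 U, Kembedding N1 U g &
                  forall x, univ M x -> g (h1 x) = h0 x].
Proof.
move=> AP Ml N0l N1l e0 e1.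
have rename N h : inK_card K lambda N -> Kembedding M N h ->
    exists N' k', [/\ prec M N', inK_card K lambda N', isomorphism N N' k' &
      forall x, univ M x -> k' (h x) = x].
  move=> Nl e; have [N' [k [MN' isok kh]]] := Kembedding_rename e.
  have [k' [isok' k'K kK]] := isomorphism_inverse isok.
  exists N', k'; split=> //; first exact: inK_card_iso Nl isok'.
  by move=> x Mx; rewrite -kh// k'K//; have [+ _ _] := prec_sub MN'; apply.
have [N0' [k0 [MN0 N0l' iso0 k0h]]] := rename _ _ N0l e0.
have [N1' [k1 [MN1 N1l' iso1 k1h]]] := rename _ _ N1l e1.
have [P [f0 [f1 [KP P0 P1 f01]]]] := AP _ _ _ Ml N0l' N1l' MN0 MN1.
have F0 := Kembedding_comp (isomorphism_Kembedding (proj1 N0l') iso0) P0.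
have F1 := Kembedding_comp (isomorphism_Kembedding (proj1 N1l') iso1) P1.
have [Q [Ql Q0 Q1]] := cut_to_lambda N0l N1l F0 F1.
have [U [g [Ul N0U N1U gE]]] := absorb_target Ql Q0 Q1.
exists U, g; split=> // x Mx; apply: gE.
- by case: e0 => -[+ _ _ _] _; apply.
- by case: e1 => -[+ _ _ _] _; apply.
- by rewrite /= k0h// k1h// f01.
Qed.

Lemma joint_mapping_extension N0 N1 : joint_mapping K lambda ->
  inK_card K lambda N0 -> inK_card K lambda N1 ->
  exists U g, [/\ inK_card K lambda U, prec N0 U & Kembedding N1 U g].
Proof.
move=> JMP N0l N1l; have [P [f0 [f1 [KP e0 e1]]]] := JMP _ _ N0l N1l.
have [Q [Ql Q0 Q1]] := cut_to_lambda N0l N1l e0 e1.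
by have [U [g [Ul N0U N1U _]]] := absorb_target Ql Q0 Q1; exists U, g.
Qed.

End Kembeddings.

(** * Continuous chains *)

Lemma injects_small (A : set ambient) (T : cardinal) : injects A T -> small A.
Proof.
move=> [i iI]; exists {t | exists a, i a = t}; apply/card_eq_injectsP; split.
  exists (fun a => exist _ (i a) (ex_intro _ a erefl)) => a b [].
  exact: iI.
have /choice[c cP] : forall t : {t | exists a, i a = t}, exists a, i a = sval t.
  by move=> t; exact: (proj2_sig t).
by exists c => s t st; apply: sval_inj; rewrite -!cP st.
Qed.

Section Union.
Context {L : language}.
Variables (I : cardinal) (Ms : I -> structure L).
Hypothesis I_inhabited : inhabited I.
Hypothesis directed : forall i j, exists k,
  substructure (Ms i) (Ms k) /\ substructure (Ms j) (Ms k).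

Lemma directed_tuple n (x : 'I_n -> ambient) :
  (forall i, (\bigcup_k univ (Ms k)) (x i)) ->
  exists k, forall i, univ (Ms k) (x i).
Proof.
move=> Ux.
suff [k kP] : exists k, forall i, i \in enum 'I_n -> univ (Ms k) (x i).
  by exists k => i; apply: kP; rewrite mem_enum.
elim: (enum 'I_n) => [|i s [k kP]]; first by case: I_inhabited => k; exists k.
have [j _ jx] := Ux i; have [l [[jl _ _] [kl _ _]]] := directed j k.
exists l => i'; rewrite inE => /orP[/eqP ->|/kP/kl//]; exact: jl.
Qed.

Lemma bigcup_small : small (\bigcup_k univ (Ms k)).
Proof.
have /choice[T TP] k := univ_small (Ms k).
apply: (@injects_small _ {k & T k}).
have /all_sig[g gI] k : {g : univ (Ms k) -> T k | injective g}.
  by apply: cid; have /card_eq_injectsP[] := TP k.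
have /choice[c cF] : forall x : \bigcup_k univ (Ms k), exists k, univ (Ms k) (val x).
  by move=> x; have [k _ kx] := set_mem (valP x); exists k.
exists (fun x => existT T (c x) (g (c x) (SigSub (mem_set (cF x))))) => x y E.
have cxy : c x = c y by have := congr1 (@projT1 _ _) E.
move: (cF x) (cF y) E; rewrite cxy => cx cy.
move=> /(@existT_inj2 (HB.pack I (gen_eqMixin I)) T)/gI[].
exact: val_inj.
Qed.

(** An operation is evaluated in any member containing the tuple; a common extension of two members
    shows that the choice does not matter. *)
Lemma directed_union : exists U, is_union Ms setT U.
Proof.
pose inside n (x : 'I_n -> ambient) k := forall i, univ (Ms k) (x i).
pose fU f (x : 'I_(farity f) -> ambient) :=
  if pselect (exists k, inside _ x k) is left h
  then fint (Ms (sval (cid h))) f x else existT id unit tt.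
pose rU r (x : 'I_(rarity r) -> ambient) :=
  exists2 k, inside _ x k & rint (Ms k) r x.
have closed f x : (forall i, (\bigcup_k univ (Ms k)) (x i)) ->
    (\bigcup_k univ (Ms k)) (fU f x).
  move=> /directed_tuple ex; rewrite /fU; case: pselect => // h.
  by case: (cid h) => k kx /=; exists k => //; exact: fint_closed.
exists (@Structure L _ fU rU bigcup_small closed); split=> // k _.
split=> /= [x kx|f x kx|r x kx]; first by exists k.
  rewrite /fU; case: pselect => [h|[]]; last by exists k.
  case: (cid h) => j jx /=.
  have [l [[_ jl _] [_ kl _]]] := directed j k.
  by rewrite jl// kl.
split=> [kr|[j jx jr]]; first by exists k.
have [l [[_ _ jl] [_ _ kl]]] := directed j k.
by apply/kl => //; apply/jl.
Qed.

End Union.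

Section Chains.
Variables (K : AEC) (lambda : cardinal).
Hypothesis lambda_ge_LS : [set: LS K] #<= [set: lambda].

(* A continuous chain of length [I] handles the requirements [Phi i] one at a
   time. *)
Lemma fulfil_all (I : cardinal) (Phi : I -> structure (lang K) -> Prop) M0 :
  injects I lambda -> inK_card K lambda M0 ->
  (forall i U U', prec U U' -> Phi i U -> Phi i U') ->
  (forall i U, inK_card K lambda U -> prec M0 U ->
    exists U', [/\ inK_card K lambda U', prec U U' & Phi i U']) ->
  exists U, [/\ inK_card K lambda U, prec M0 U & forall i, Phi i U].
Proof.
move=> Il M0l Phi_mono Phi_ex; have [le wo] := exists_well_order I.
pose lim (S : set I) := S !=set0 /\
  forall j, S j -> exists2 k, S k & strictly_below le k j.
(* [R S B U] says that [U] may follow the stages of [B] indexed by [S]. During the recursion [S]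
   consists of the predecessors of an index, at the end of all indices. *)
pose R (S : set I) B U := [/\ inK_card K lambda U, prec M0 U,
  forall j, S j -> prec (B j) U, forall j, S j -> Phi j U &
  lim S -> is_union B S U].
have extend S B : (forall i j, S i -> le j i -> S j) ->
    (forall j, S j -> R (strictly_below le j) B (B j)) -> exists U, R S B U.
  move=> Sinit BR.
  (* The chain starts at [M0] when [S] is empty; a last index [j] calls for the step serving
     [Phi j]; otherwise [S] is a limit and the union is taken. *)
  have [->|/set0P Sn0] := eqVneq S set0.
    exists M0; split=> //; first by apply: prec_refl; case: M0l.
    by case=> -[].
  have [[j Sj jmax]|nomax] := pselect (exists2 j, S j & forall k, S k -> le k j).
    have [Bjl M0Bj Bprec BPhi _] := BR j Sj.
    have [U [Ul BjU PhiU]] := Phi_ex j _ Bjl M0Bj.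
    exists U; split=> //; first exact: prec_trans BjU.
    - move=> k Sk; have [->//|kj] := pselect (k = j).
      by apply: prec_trans BjU; apply: Bprec; split=> //; exact: jmax.
    - move=> k Sk; have [->//|kj] := pselect (k = j).
      by apply: Phi_mono BjU _; apply: BPhi; split=> //; exact: jmax.
    - move=> [_ /(_ j Sj)[k Sk [jk ne]]].
      by case: ne; apply: (wo_antisym wo) => //; exact: jmax.
  have limS : lim S.
    split=> // j Sj; apply: contrapT => nk; apply: nomax; exists j => // k Sk.
    by apply: (wo_not_below wo) => jk; apply: nk; exists k.
  have mono i j : S i -> S j -> le i j -> prec (B i) (B j).
    move=> Si Sj ij; have [->|ne] := pselect (i = j).
      by apply: prec_refl; have [[]] := BR j Sj.
    by have [_ _ + _ _] := BR j Sj; apply.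
  (* The union axioms concern chains indexed by a whole type, so the stages in [S] are reindexed. *)
  pose J : cardinal := {j | S j}; pose leJ : rel J := fun a b => le (sval a) (sval b).
  pose Ms (a : J) := B (sval a).
  have J_inhabited : inhabited J by case: Sn0 => j Sj; constructor; exists j.
  have [U [UE Usub]] : exists U, is_union Ms setT U.
    apply: directed_union => // -[i Si] [j Sj].
    have [ij|ji] := wo_total wo i j.
      exists (exist _ j Sj); split; last exact: substructure_refl.
      exact/prec_sub/mono.
    exists (exist _ i Si); split; first exact: substructure_refl.
    exact/prec_sub/mono.
  have chain_Ms : continuous_chain prec leJ Ms.
    split=> //; first exact: wo_sub.
      by move=> [i Si] [j Sj]; exact: mono.
    move=> [i Si] [[[k Sk] ik] lim_i].
    (* As [S] is an initial segment, limit indices of [J] are limit indices of [I], where [R]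
       already provides the union. *)
    have below_S j : strictly_below le i j -> S j by case=> ji _; exact: Sinit ji.
    have belowE j (Sj : S j) : strictly_below le i j <->
        strictly_below leJ (exist _ i Si) (exist _ j Sj).
      by split=> -[ji ne]; split=> //; [case|move=> E; apply: ne; exact: eq_exist].
    have [_ _ _ _] := BR i Si; case.
      split; first by exists k; exact/(belowE _ Sk).
      move=> j ij; have h := (belowE j (below_S j ij)).1 ij.
      have [[l Sl] /belowE il [jl jNl]] := lim_i _ h.
      exists l => //; split=> // E; apply: jNl; exact: eq_exist.
    move=> BE Bsub; split.
      rewrite /Ms /= BE; apply/seteqP; split=> x.
        move=> [j ij jx]; exists (exist _ j (below_S _ ij)) => //.
        exact/belowE.
      by move=> [[j Sj] /belowE ij jx]; exists j.
    by move=> [j Sj] /belowE; exact: Bsub.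
  have [KU MsU] := union_inK chain_Ms (conj UE Usub).
  have BU j : S j -> prec (B j) U by move=> Sj; exact: (MsU (exist _ j Sj)).
  exists U; split=> //.
  - apply/inK_cardP; split=> //.
      rewrite UE; apply: injects_bigcup (lambda_infinite lambda_ge_LS) _ _.
        by apply: injects_trans Il; exists sval; exact: sval_inj.
      by move=> [j Sj]; have [/inK_cardP[]] := BR j Sj.
    case: Sn0 => j Sj; have [/inK_cardP[_ _ lBj] _ _ _ _] := BR j Sj.
    apply: injects_trans lBj _; apply: injects_subset.
    by have [] := prec_sub (BU j Sj).
  - case: Sn0 => j Sj; have [_ M0Bj _ _ _] := BR j Sj.
    exact: prec_trans (BU j Sj).
  (* [Phi j] is met at some stage [k] after [j] and persists in the union. *)
  - move=> j Sj; case: limS => _ /(_ j Sj)[k Sk kj].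
    by apply: Phi_mono (BU k Sk) _; have [_ _ _ + _] := BR k Sk; exact.
  - move=> _; split=> [|j Sj]; last exact: (Usub (exist _ j Sj)).
    rewrite UE; apply/seteqP; split=> x; first by move=> [[j Sj] _ jx]; exists j.
    by move=> [j Sj jx]; exists (exist _ j Sj).
have [||B BP] := @wo_recursion _ _ wo _ (fun i => R (strictly_below le i)) (inhabits M0).
- move=> i B B' U BB' [Ul M0U BU PhiU unionU]; split=> // [j ij|/unionU[UE Usub]].
    by rewrite -BB'//; exact: BU.
  split=> [|j ij]; last by rewrite -BB'//; exact: Usub.
  by rewrite UE; apply: eq_bigcupr => j ij; rewrite BB'.
- by move=> i B; apply: extend => j k; exact: (wo_below_le wo).
(* One more stage after the whole chain; this also covers an empty [I]. *)
have [//|//|U [Ul M0U _ PhiU _]] := extend setT B.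
by exists U; split=> // i; exact: PhiU.
Qed.

End Chains.

(** * Galois types *)

Section GaloisTypes.
Variable K : AEC.
Implicit Types (M N U : structure (lang K)) (I J : cardinal).

Lemma atomic_equiv_sym I M (p q : pretype I M) :
  atomic_equiv p q -> atomic_equiv q p.
Proof.
move=> [N [f [g [KN pf qg fg Efg]]]]; exists N, g, f; split=> //.
by move=> x Mx; rewrite fg.
Qed.

(** [atomic_equiv] is reflexive by identity maps and symmetric, so its transitive closure is an
    equivalence with classes [gtp p]. *)
Lemma gtp_eqP I M (p q : pretype I M) :
  gtp p = gtp q <-> clos_trans _ (@atomic_equiv K I M) p q.
Proof.
have sym (r s : pretype I M) : clos_trans _ (@atomic_equiv K I M) r s ->
    clos_trans _ (@atomic_equiv K I M) s r.
  elim=> [{}r {}s rs|{}r r' {}s _ sr _ ts]; last exact: t_trans ts sr.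
  by apply: t_step; exact: atomic_equiv_sym.
split=> [E|pq].
  suff : gtp q q by rewrite -E.
  apply: t_step; exists (model q), id, id; have := prec_model q => /prec_inK[_ Kq].
  by split=> //; exact/prec_Kembedding/prec_refl.
apply/seteqP; split=> r; last exact: t_trans.
by apply: t_trans; exact: sym.
Qed.

Lemma gS_repr I M (t : gS K I M) : exists p : pretype I M, gtp p = val t.
Proof. by have [p _ pt] := set_mem (valP t); exists p. Qed.

Definition type_class I M (p : pretype I M) : gS K I M :=
  SigSub (mem_set (imageT (@gtp K I M) p)).

Lemma type_class_injects I M X (c : X -> pretype I M) :
  (forall x y, gtp (c x) = gtp (c y) -> x = y) -> injects X (gS K I M).
Proof. by move=> cI; exists (fun x => type_class (c x)) => x y /(congr1 val) /= /cI. Qed.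

(** In an atomic step [g] maps [elts q i] and [elts p i] to the same point, as [f] and [g] agree on
    [M]; and [g] is injective. *)
Lemma gtp_base I M (p q : pretype I M) : gtp p = gtp q ->
  (forall i, univ M (elts p i)) -> forall i, elts q i = elts p i.
Proof.
move/gtp_eqP; elim=> {p q} [p q [N [f [g [_ _ [[_ gI _ _] _] fg Efg]]]]
    |p q r _ IHpq _ IHqr] Mp i.
  have [MU _ _] := prec_sub (prec_model q).
  apply: gI; rewrite ?inE; [exact: elts_model|exact: MU|].
  by rewrite -Efg fg.
have pq := IHpq Mp.
by rewrite IHqr// => j; rewrite pq.
Qed.

(* A type whose components lie in [M] is determined by these components. *)
Lemma injects_base_types I M N : prec M N -> univ N #= [set: univ M + I] ->
  injects (I -> univ M) (gS K I M).
Proof.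
move=> MN Ncard.
have inN (a : I -> univ M) i : univ N (val (a i)).
  by have [+ _ _] := prec_sub MN; apply; exact: set_mem (valP (a i)).
apply: (@type_class_injects _ _ _ (fun a => Pretype MN Ncard (inN a))).
move=> a b E; apply/funext => i; apply: val_inj; apply/esym.
by apply: (gtp_base E) => j; exact: set_mem (valP (a j)).
Qed.

(* [r] is the type of the subfamily along [s] of [q], restricted along [h]. *)
Definition pulls_back I J M N (h : ambient -> ambient) (s : J -> I)
    (r : pretype J M) (q : pretype I N) :=
  exists k, [/\ Kembedding (model r) (model q) k,
    forall x, univ M x -> k x = h x & forall j, k (elts r j) = elts q (s j)].

(** The maps that amalgamate [q] and [q'] do so for [r] and [r'] after composition with [k] and
    [k']. *)
Lemma pulls_back_atomic I J M N h (s : J -> I) (r r' : pretype J M)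
    (q q' : pretype I N) : Kembedding M N h ->
  pulls_back h s r q -> pulls_back h s r' q' ->
  atomic_equiv q q' -> atomic_equiv r r'.
Proof.
move=> [[hMN _ _ _] _] [k [kK kh ks]] [k' [kK' kh' ks']].
move=> [U [f [g [KU fU gU fg Efg]]]]; exists U, (f \o k), (g \o k'); split=> //=.
- exact: Kembedding_comp fU.
- exact: Kembedding_comp gU.
- by move=> x Mx; rewrite kh// kh'// fg//; exact: hMN.
- by move=> j; rewrite ks ks'.
Qed.

Section Lambda.
Variable lambda : cardinal.
Hypothesis lambda_ge_LS : [set: LS K] #<= [set: lambda].
Local Notation Kl := (inK_card K lambda).

Lemma card_pretype_model M I : Kl M -> injects I lambda ->
  [set: univ M + I] #= [set: lambda].
Proof.
move=> /inK_cardP[_ Ml lM] Il; apply/card_eqPle; split; apply/card_leTTP.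
  exact: injects_sum_infinite (lambda_infinite lambda_ge_LS) _ _.
by apply: injects_trans lM _; exists inl => x y [].
Qed.

Lemma model_inK_card M I (p : pretype I M) : Kl M -> injects I lambda ->
  Kl (model p).
Proof.
move=> Ml Il; split; first by have [] := prec_inK (prec_model p).
exact: card_eq_trans (card_model p) (card_pretype_model Ml Il).
Qed.

Lemma inK_card_model M I U : Kl M -> injects I lambda -> Kl U ->
  univ U #= [set: univ M + I].
Proof.
move=> Ml Il [_ Ul]; apply: card_eq_trans Ul _.
by rewrite card_eq_sym; exact: card_pretype_model.
Qed.

(** The model of [q] is renamed so that [h] becomes an inclusion. This restricts the intermediate
    pretypes of a chain of atomic equivalences. *)
Lemma pulls_back_exists I J M N h (s : J -> I) (q : pretype I N) :
  Kl M -> Kl N -> injects I lambda -> injects J lambda -> Kembedding M N h ->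
  exists r : pretype J M, pulls_back h s r q.
Proof.
move=> Ml Nl Il Jl hMN.
have [U [e [MU isoe eh]]] := Kembedding_rename (Kembedding_precr hMN (prec_model q)).
have [e' [isoe' e'K eK]] := isomorphism_inverse isoe.
have ql := model_inK_card q Nl Il.
have Ul := inK_card_iso ql isoe'.
have eltsU j : univ U (e' (elts q (s j))).
  by case: isoe' => -[+ _ _ _] _; apply; exact: elts_model.
exists (Pretype MU (inK_card_model Ml Jl Ul) eltsU), e; split=> //=.
  by apply: isomorphism_Kembedding isoe; case: ql.
by move=> j; rewrite eK//; exact: elts_model.
Qed.

(** Restriction is well defined on types, because a chain of atomic equivalences pulls back link by
    link. *)
Lemma pulls_back_gtp I J M N h (s : J -> I) (r r' : pretype J M)
    (q q' : pretype I N) :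
  Kl M -> Kl N -> injects I lambda -> injects J lambda -> Kembedding M N h ->
  pulls_back h s r q -> pulls_back h s r' q' -> gtp q = gtp q' -> gtp r = gtp r'.
Proof.
move=> Ml Nl Il Jl hMN rq rq' /gtp_eqP qq'; apply/gtp_eqP.
elim: qq' r r' rq rq' => [{}q {}q' qq'|{}q q1 {}q' _ IH _ IH'] r r' rq rq'.
  by apply: t_step; exact: pulls_back_atomic hMN rq rq' qq'.
have [r1 rq1] := pulls_back_exists s q1 Ml Nl Il Jl hMN.
exact: t_trans (IH _ _ rq rq1) (IH' _ _ rq1 rq').
Qed.

Hypothesis AP : amalgamation K lambda.

(** Amalgamation extends each type over [M] to one over [N], and restriction along [h] recovers
    it. *)
Lemma injects_gS_extension I M N h : Kl M -> Kl N -> injects I lambda ->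
  Kembedding M N h -> injects (gS K I M) (gS K I N).
Proof.
move=> Ml Nl Il hMN; have /choice[rep repE] := @gS_repr I M.
have ext t : exists q : pretype I N, pulls_back h id (rep t) q.
  set p := rep t; have pl := model_inK_card p Ml Il.
  have [U [g [Ul NU gU gh]]] := amalgamation_extension lambda_ge_LS AP Ml Nl pl
    hMN (prec_Kembedding (prec_model p)).
  have eltsU i : univ U (g (elts p i)).
    by case: gU => -[+ _ _ _] _; apply; exact: elts_model.
  by exists (Pretype NU (inK_card_model Nl Il Ul) eltsU), g; split.
have [c cP] := choice ext; apply: (type_class_injects (c := c)) => t t' E.
apply: val_inj; rewrite -!repE.
exact: pulls_back_gtp (cP t) (cP t') E.
Qed.

(** All types of a family are realized in one model, and restricting the [I]-type of the
    realizations to coordinate [i] recovers the member at [i]. *)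
Lemma injects_types_short I M : Kl M -> injects I lambda ->
  injects (I -> gS K unit M) (gS K I M).
Proof.
move=> Ml Il; have /choice[rep repE] := @gS_repr unit M.
have unitl := injects_unit_infinite (lambda_infinite lambda_ge_LS).
have KidM := prec_Kembedding (prec_refl (proj1 Ml)).
have real (phi : I -> gS K unit M) : exists p : pretype I M,
    forall i, pulls_back id (fun=> i) (rep (phi i)) p.
  pose Phi i U := exists2 g, Kembedding (model (rep (phi i))) U g &
    forall x, univ M x -> g x = x.
  have [||U [Ul MU PhiU]] := fulfil_all lambda_ge_LS (Phi := Phi) Il Ml.
  - move=> i U U' UU' [g gU gM]; exists g => //; exact: Kembedding_precr UU'.
  - move=> i U Ul MU; set p := rep (phi i).
    have [U' [g [Ul' UU' gU' gM]]] := amalgamation_extension lambda_ge_LS AP Ml Ul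
      (model_inK_card p Ml unitl) (prec_Kembedding MU) (prec_Kembedding (prec_model p)).
    by exists U'; split=> //; exists g.
  have /choice[g gP] : forall i, exists g, Kembedding (model (rep (phi i))) U g /\
      forall x, univ M x -> g x = x.
    by move=> i; have [g gU gM] := PhiU i; exists g.
  have eltsU i : univ U (g i (elts (rep (phi i)) tt)).
    by have [[[+ _ _ _] _] _] := gP i; apply; exact: elts_model.
  exists (Pretype MU (inK_card_model Ml Il Ul) eltsU) => i.
  by exists (g i); have [gU gM] := gP i; split=> // -[].
have [c cP] := choice real; apply: (type_class_injects (c := c)) => phi psi E.
apply/funext => i; apply: val_inj; rewrite -!repE.
exact: pulls_back_gtp (cP phi i) (cP psi i) E.
Qed.

(** Distinct points of [M] have distinct types over [M]. *)
Lemma types_infinite M : Kl M -> injects lambda (gS K unit M).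
Proof.
move=> Ml; have unitl := injects_unit_infinite (lambda_infinite lambda_ge_LS).
apply: injects_trans (injects_base_types (prec_refl (proj1 Ml))
  (inK_card_model Ml unitl Ml)).
have /inK_cardP[_ _ [f fI]] := Ml.
by exists (fun l => fun=> f l) => l l' /(congr1 (@^~ tt)) /fI.
Qed.

End Lambda.
End GaloisTypes.

(** * Coding types by subsets of [lambda] *)

Lemma card_coordinates (A : set ambient) (T : cardinal) (t0 : T) :
  A #= [set: T] ->
  exists c : (ambient -> T) * (T -> ambient),
    [/\ forall t, A (c.2 t), forall t, c.1 (c.2 t) = t &
        forall x, A x -> c.2 (c.1 x) = x].
Proof.
move=> /card_bijP[f [g fK gK]].
exists (fun x => if pselect (A x) is left h then val (f (SigSub (mem_set h))) else t0,
        fun t => val (g (SigSub (mem_set (I : [set: T] t))))).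
split=> [t|t|x Ax] /=; first exact: set_mem (valP _).
  case: pselect => [h|[]]; last exact: set_mem (valP _).
  rewrite (_ : SigSub _ = g (SigSub (mem_set (I : [set: T] t)))) ?gK//.
  exact: val_inj.
case: pselect => // h; rewrite -[RHS](congr1 val (fK (SigSub (mem_set h)))).
by congr (val (g _)); exact: val_inj.
Qed.

Section Coding.
Variables (K : AEC) (lambda : cardinal).
Hypothesis lambda_ge_LS : [set: LS K] #<= [set: lambda].

(* Transporting the model of a pretype to [lambda] codes its type over [M] by a
   subset of a set of size [lambda]. *)
Lemma injects_types_Prop M : inK_card K lambda M ->
  injects (gS K unit M) (lambda -> Prop).
Proof.
move=> Ml; have nl := lambda_infinite lambda_ge_LS.
have unitl := injects_unit_infinite nl.
pose L := lang K.
(* The summands record the operations, the relations, the position of [M] and the realizing element;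
   sequences stand for tuples, so that one type serves all arities. *)
pose D : cardinal := (fsymbol L * (seq lambda * lambda) +
  (rsymbol L * seq lambda + (lambda * lambda + lambda)))%type.
have /injects_Prop : injects D lambda.
  have ll := injects_refl lambda; have sl := injects_seq_infinite nl ll.
  have [_ /card_leTTP Ll _] := LS_is_bound K.
  have {}Ll : injects (fsymbol L + rsymbol L) lambda.
    by apply: injects_trans Ll _; exact/card_leTTP.
  have fl : injects (fsymbol L) lambda.
    by apply: injects_trans Ll; exists inl => x y [].
  have rl : injects (rsymbol L) lambda.
    by apply: injects_trans Ll; exists inr => x y [].
  by do !(apply: injects_sum_infinite => //); do !(apply: injects_prod_infinite => //).
apply: injects_trans.
have [e _] := nl.
have [[m' m] /= [_ _ mK]] := card_coordinates (e 0) (proj2 Ml).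
have /choice[C CP] (p : pretype unit M) :=
  card_coordinates (e 0) (proj2 (model_inK_card lambda_ge_LS p Ml unitl)).
pose code (p : pretype unit M) (d : D) : Prop := match d with
  | inl (f, (s, l)) => exists2 y, s = [seq y i | i <- enum 'I_(farity f)] &
      (C p).1 (fint (model p) f ((C p).2 \o y)) = l
  | inr (inl (r, s)) => exists2 y, s = [seq y i | i <- enum 'I_(rarity r)] &
      rint (model p) r ((C p).2 \o y)
  | inr (inr (inl (l, l'))) => (C p).1 (m l) = l'
  | inr (inr (inr l)) => (C p).1 (elts p tt) = l
  end.
have codeP p q : code p = code q -> gtp p = gtp q.
  move=> /funeqP pq; apply/gtp_eqP/t_step.
  have [pN pK Kp] := CP p; have [qN qK Kq] := CP q.
  set c := (C p).1 in pK Kp; set c' := (C p).2 in pN pK Kp.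
  set d := (C q).1 in qK Kq; set d' := (C q).2 in qN qK Kq.
  (* Points with equal coordinates are matched; equality of the codes makes this an isomorphism that
     fixes [M] and matches the realizing elements. *)
  pose h := d' \o c.
  have yE n (y z : 'I_n -> lambda) :
      [seq y i | i <- enum 'I_n] = [seq z i | i <- enum 'I_n] -> y = z.
    by move=> /eq_in_map E; apply/funext => i; apply: E; rewrite mem_enum.
  have c'cx n (x : 'I_n -> ambient) :
      (forall i, univ (model p) (x i)) -> c' \o (c \o x) = x.
    by move=> Nx; apply/funext => i /=; rewrite Kp.
  have isoh : isomorphism (model p) (model q) h.
    split; last first.
      apply/seteqP; split=> [_ [x _ <-]|y qy]; first exact: qN.
      by exists (c' (d y)); [exact: pN|rewrite /h /= pK Kq].
    split=> [x _|x y /set_mem px /set_mem py|f x px|r x px].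
    - exact: qN.
    - by move=> /(congr1 d); rewrite /h /= !qK => /(congr1 c'); rewrite !Kp.
    - have := pq (inl (f, ([seq (c \o x) i | i <- enum 'I_(farity f)],
          c (fint (model p) f x)))).
      rewrite propeqE => -[+ _] => -[].
        by exists (c \o x); rewrite // c'cx.
      move=> y /yE <- E; rewrite /h /= -E Kq//.
      by apply: fint_closed => i; exact: qN.
    - have := pq (inr (inl (r, [seq (c \o x) i | i <- enum 'I_(rarity r)]))).
      rewrite propeqE => -[p_q q_p]; split=> [pr|qr].
        have [|y /yE <- //] := p_q; exists (c \o x) => //.
        by rewrite c'cx.
      have [|y /yE <-] := q_p; first by exists (c \o x).
      by rewrite c'cx.
  exists (model q), h, id; have [_ Kmq] := prec_inK (prec_model q).
  split=> //.
  - exact: isomorphism_Kembedding isoh.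
  - exact/prec_Kembedding/prec_refl.
  - move=> x Mx; rewrite -(mK x Mx); set l := m' x.
    have [MU _ _] := prec_sub (prec_model q).
    have := pq (inr (inr (inl (l, d (m l))))); rewrite propeqE /= => -[_ /(_ erefl)].
    by rewrite -/c /h /= => ->; rewrite Kq// mK//; exact: MU.
  - case; have := pq (inr (inr (inr (d (elts q tt))))).
    by rewrite propeqE /= => -[_ /(_ erefl)]; rewrite -/c /h /= => ->; rewrite Kq//; exact: elts_model.
have /choice[rep repE] := @gS_repr K unit M.
by exists (code \o rep) => s t /codeP E; apply: val_inj; rewrite -!repE.
Qed.

End Coding.

(** * Type bounds *)

Lemma injects_curry I A : injects (I -> A -> Prop) (I * A -> Prop).
Proof.
exists (fun u x => u x.1 x.2) => u v /funeqP uv.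
by apply/funext => i; apply/funext => a; exact: (uv (i, a)).
Qed.

Lemma injects_Prop_infinite X : injects nat X -> injects Prop X.
Proof.
move=> [e eI]; exists (fun P => e `[< P >]) => P Q /eI PQ; apply/propext.
have {}PQ : `[< P >] = `[< Q >] by move: PQ; do 2!case: asboolP.
by split=> /asboolP; [rewrite PQ|rewrite -PQ] => /asboolP.
Qed.

Lemma injects_sig T (A : set T) : injects A {x | A x}.
Proof.
exists (fun x : A => exist A (val x) (set_mem (valP x))) => x y [].
exact: val_inj.
Qed.

Section TypeBound.
Variables (K : AEC) (lambda kappa : cardinal).
Hypothesis lambda_ge_LS : [set: LS K] #<= [set: lambda].
Hypothesis AP : amalgamation K lambda.
Hypothesis JMP : joint_mapping K lambda.
Local Notation Kl := (inK_card K lambda).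

Lemma tb_upper I M : Kl M -> injects (gS K I M) (tb K I lambda).
Proof.
move=> Ml; have [/(_ (SigSub (mem_set Ml)))/card_leTTP] := card_supP
  (fun M : inK_card K lambda => gS K I (val M)); exact.
Qed.

Lemma tb_least I Y : (forall M, Kl M -> injects (gS K I M) Y) ->
  injects (tb K I lambda) Y.
Proof.
move=> ubY; have [_ least] := card_supP
  (fun M : inK_card K lambda => gS K I (val M)).
apply/card_leTTP/least => M; apply/card_leTTP/ubY; exact: set_mem (valP M).
Qed.

(** Sequences from [M] are told apart by their types, and [M] has more than one point. [N] provides
    the model of size [kappa] that a pretype of this length requires. *)
Lemma injects_types_long M N : injects lambda kappa -> Kl M -> prec M N ->
  univ N #= [set: kappa] -> injects (kappa -> Prop) (gS K kappa M).
Proof.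
move=> lk /inK_cardP[_ Ml lM] MN Nk; have nl := lambda_infinite lambda_ge_LS.
apply: injects_trans (injects_base_types MN _).
  by apply/injects_fun/injects_Prop_infinite; exact: injects_trans lM.
apply: card_eq_trans Nk _; apply/card_eqPle; split; apply/card_leTTP.
  by exists inr => x y [].
apply: injects_sum_infinite (injects_refl _); first exact: injects_trans lk.
exact: injects_trans lk.
Qed.

(** (2^lambda)^kappa = 2^(kappa * lambda) = 2^kappa. *)
Lemma injects_power_long X : injects lambda kappa -> injects X (lambda -> Prop) ->
  injects (kappa -> X) (kappa -> Prop).
Proof.
move=> lk Xl; apply: injects_trans (injects_fun _ Xl) _.
apply: injects_trans (@injects_curry _ _) _; apply: injects_Prop.
apply: injects_prod_infinite (injects_refl _) (lk).
exact: injects_trans (lambda_infinite lambda_ge_LS) lk.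
Qed.

(** A chain starting at [M i0] absorbs one [M i] at a time by joint mapping. *)
Lemma common_extension (M : kappa -> structure (lang K)) : injects kappa lambda ->
  inhabited kappa -> (forall i, Kl (M i)) ->
  exists2 N, Kl N & forall i, exists h, Kembedding (M i) N h.
Proof.
move=> kl [i0] Ml.
have [||N [Nl _ NE]] := fulfil_all lambda_ge_LS
    (Phi := fun i U => exists h, Kembedding (M i) U h) kl (Ml i0).
- by move=> i U U' UU' [h hU]; exists h; exact: Kembedding_precr UU'.
- move=> i U Ul _; have [U' [g [Ul' UU' gU']]] :=
    joint_mapping_extension lambda_ge_LS JMP Ul (Ml i).
  by exists U'; split=> //; exists g.
by exists N.
Qed.

(* If the supremum [tb^1] is not attained, then its cofinality exceeds
   [lambda]: [kappa] many models have a common extension, which realizes at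
   least as many types as each of them. So every map from [kappa] to [tb^1] is
   bounded. *)
Lemma tb_bounded : injects kappa lambda -> inhabited kappa ->
  ~ (exists2 M, Kl M & injects (tb K unit lambda) (gS K unit M)) ->
  exists lt : tb K unit lambda -> tb K unit lambda -> Prop,
    (forall t, exists2 M, Kl M & injects {s | lt s t} (gS K unit M)) /\
    forall f : kappa -> tb K unit lambda, exists t, forall i, lt (f i) t.
Proof.
move=> kl k_inhabited not_attained; have nl := lambda_infinite lambda_ge_LS.
have unitl := injects_unit_infinite nl.
have [lt [lt_total lt_small]] := initial_order (tb K unit lambda).
have segment t : exists2 M, Kl M & injects {s | lt s t} (gS K unit M).
  (* Otherwise the segment below [t] bounds the number of types over every model, so it receives the
     supremum, against [lt_small]. *)
  apply: contrapT => nM; apply: (lt_small t); apply: tb_least => M Ml.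
  by have [//|le] := injects_total (gS K unit M) {s | lt s t}; case: nM; exists M.
exists lt; split=> // f; apply: contrapT => /forallNP unbounded.
have /choice[M MP] : forall i, exists M, Kl M /\
    injects {s | lt s (f i)} (gS K unit M).
  by move=> i; have [M Ml le] := segment (f i); exists M.
have [|N Nl NE] := common_extension kl k_inhabited (M := M).
  by move=> i; have [] := MP i.
apply: not_attained; exists N => //.
have lN := types_infinite lambda_ge_LS Nl.
have nN := injects_trans nl lN.
(* Since [f] is unbounded, the closed segments up to the [f i] cover the whole order; each injects
   into the types over [N], hence so does their union. *)
apply: (injects_trans (B := \bigcup_i ([set f i] `|` [set s | lt s (f i)]))).
  apply/card_ge_injectsP; rewrite (_ : \bigcup_i _ = setT) ?card_lexx//.
  apply/seteqP; split=> // t _.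
  have /existsNP[i ni] := unbounded t; exists i => //.
  by have [|->|] := lt_total t (f i); [right|left|move/ni].
apply: (injects_bigcup nN) => [|i /=]; first exact: injects_trans lN.
apply: (injects_setU nN).
  apply: injects_trans (injects_unit_infinite nN).
  by exists (fun=> tt) => x y _; apply: val_inj; rewrite (set_mem (valP x)) (set_mem (valP y)).
have [Ml le] := MP i; have [h hN] := NE i.
apply: injects_trans (@injects_sig _ _) _; apply: injects_trans le _.
exact: (injects_gS_extension lambda_ge_LS AP Ml Nl unitl hN).
Qed.

Lemma injects_tb_short : injects kappa lambda -> inhabited kappa ->
  (exists M, Kl M) ->
  injects (kappa -> tb K unit lambda) (tb K kappa lambda).
Proof.
move=> kl k_inhabited [M0 M0l].
have short M : Kl M -> injects (kappa -> gS K unit M) (tb K kappa lambda).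
  move=> Ml; apply: injects_trans (tb_upper kappa Ml).
  exact: (injects_types_short lambda_ge_LS AP).
have [[M Ml le]|not_attained] := pselect
    (exists2 M, Kl M & injects (tb K unit lambda) (gS K unit M)).
  by apply: injects_trans (short M Ml); exact: injects_fun.
have [lt [segment bounded]] := tb_bounded kl k_inhabited not_attained.
have tb_le : injects (tb K unit lambda) (tb K kappa lambda).
  apply: tb_least => M Ml; apply: injects_trans (short M Ml).
  by case: k_inhabited => i; exists (fun t => fun=> t) => s t /(congr1 (@^~ i)).
have nl := lambda_infinite lambda_ge_LS.
have ntb : injects nat (tb K kappa lambda).
  apply: injects_trans nl _; apply: injects_trans tb_le.
  by apply: injects_trans (tb_upper unit M0l); exact: (types_infinite lambda_ge_LS).
apply: injects_trans (injects_prod_infinite ntb tb_le (injects_refl _)).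
have /all_sig[G GI] t :
    {G : (kappa -> {s | lt s t}) -> tb K kappa lambda | injective G}.
  apply: cid; have [M Ml le] := segment t.
  by apply: injects_trans (short M Ml); exact: injects_fun.
have /choice[b bP] := bounded.
(* [f] is coded by its bound [b f] together with [f] itself as a map into the segment below that
   bound. *)
exists (fun f => (b f, G (b f) (fun i => exist _ (f i) (bP f i)))) => f g [].
move: (bP f) (bP g) => + + bfg; rewrite bfg => hf hg /GI/funeqP E.
by apply/funext => i; have /(congr1 sval) := E i.
Qed.

End TypeBound.

Theorem theorem3p2 (K : AEC) (lambda kappa : cardinal)
    (lambda_ge_LS : [set: LS K] #<= [set: lambda])
    (AP : amalgamation K lambda)
    (JMP : joint_mapping K lambda)
    (* If kappa = 0, then (tb^1)^kappa = 1, while tb^kappa = sup of the empty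
       family = 0 when K_lambda is empty. *)
    (nonempty : inhabited kappa \/ exists M, inK_card K lambda M)
    (* Trivially true (N = M) unless kappa > lambda, where it says that
       gS^kappa(M) is nonempty. *)
    (extends : [set: lambda] #<= [set: kappa] ->
      forall M, inK_card K lambda M ->
        exists N, prec M N /\ univ N #= [set: kappa]) :
  [set: kappa -> tb K unit lambda] #<= [set: tb K kappa lambda] /\
  forall M, inK_card K lambda M ->
    [set: kappa -> gS K unit M] #<= gS K kappa M.
Proof.
have long M : injects lambda kappa -> inK_card K lambda M ->
    injects (kappa -> Prop) (gS K kappa M).
  move=> lk Ml; have [|N [MN Nk]] := extends _ M Ml; first exact/card_leTTP.
  exact: (injects_types_long lambda_ge_LS lk Ml MN Nk).
have local M : inK_card K lambda M ->
    injects (kappa -> gS K unit M) (gS K kappa M).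
  move=> Ml; have [kl|lk] := injects_total kappa lambda.
    exact: (injects_types_short lambda_ge_LS AP).
  apply: injects_trans (long M lk Ml); apply: (injects_power_long lambda_ge_LS lk).
  exact: (injects_types_Prop lambda_ge_LS).
split=> [|M Ml]; last by apply/card_ge_injectsP; exact: local.
apply/card_leTTP.
have [[M Ml]|noM] := pselect (exists M, inK_card K lambda M); last first.
  case: nonempty => // -[i].
  (* When [K_lambda] is empty, so is [tb^1], and an inhabited [kappa] has no map into it. *)
  have [|g _] := @tb_least K lambda unit False; first by move=> M Ml; case: noM; exists M.
  by exists (fun f => match g (f i) with end) => f; case: (g (f i)).
(* For empty [kappa] there is just one map, so one element of [tb^kappa] is enough; [local] yields a
   type over [M]. *)
have [k_inhabited|k_empty] := pselect (inhabited kappa); last first.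
  have [g _] := injects_trans (local M Ml) (tb_upper kappa Ml).
  exists (fun=> g (fun i => False_rect _ (k_empty (inhabits i)))) => f f' _.
  by apply/funext => i; case: k_empty.
have [kl|lk] := injects_total kappa lambda.
  by apply: (injects_tb_short lambda_ge_LS AP JMP) => //; exists M.
(* As 2^lambda bounds the types over every model, the 2^kappa types over the single model [M]
   suffice. *)
apply: injects_trans (tb_upper kappa Ml); apply: injects_trans (long M lk Ml).
apply: (injects_power_long lambda_ge_LS lk); apply: tb_least => N Nl.
exact: (injects_types_Prop lambda_ge_LS).
Qed.
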